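(* Let $R>0$, $\gamma=2$ and $\boldsymbol y=\boldsymbol 0$. There exist constants $c,C>0$ (independent of $\boldsymbol z,\boldsymbol\alpha,\boldsymbol\beta$) such that for all $\boldsymbol z\in B_R$ and $\boldsymbol\alpha,\boldsymbol\beta\in S$, $$c\,\frac{|\boldsymbol{\alpha}\cdot\bar{\boldsymbol{\beta}}|}{\sqrt{D_2}}\le \left|K_{(\boldsymbol 0,\boldsymbol\alpha)}(\boldsymbol z,\boldsymbol\beta)\right|\le C\,\frac{|\boldsymbol{\alpha}\cdot\bar{\boldsymbol{\beta}}|}{\sqrt{D_2}},\qquad D_2=\frac{R^6+12R^4|\boldsymbol{z}|^2+15R^2|\boldsymbol{z}|^4+2|\boldsymbol{z}|^6}{\pi\left(R^2-|\boldsymbol{z}|^2\right)^6},$$ where $K_{(\boldsymbol 0,\boldsymbol\alpha)}$ is the point spread function with parameter $\gamma=2$.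
   Context: $B_R\subset\mathbb{R}^3$ is the open ball of radius $R$ centered at the origin and $\Gamma=\partial B_R$ is the sphere of radius $R$. $S=\{\boldsymbol\alpha\in\mathbb{C}^3: |\boldsymbol\alpha|=1\}$ is the set of complex unit vectors. The dot $\cdot$ is the bilinear dot product $\boldsymbol u\cdot\boldsymbol v=\sum_i u_iv_i$ and $\times$ is the cross product extended bilinearly to $\mathbb{C}^3$. $\Delta_\Gamma$ is the Laplace-Beltrami operator on $\Gamma$, applied componentwise to vector-valued functions, and $(-\Delta_\Gamma)^0$ is the identity. For $\gamma\in\{0,2,4,\dots\}$, $\boldsymbol a\in L^2(\Gamma)^3$ and $\boldsymbol b\in H^{2\gamma}(\Gamma)^3$ (complex vector valued), $$\langle\boldsymbol a,\boldsymbol b\rangle_\gamma:=\int_\Gamma \boldsymbol a\cdot\overline{(-\Delta_\Gamma)^\gamma\boldsymbol b}\,d\Gamma,\qquad |\boldsymbol b|_\gamma=\langle\boldsymbol b,\boldsymbol b\rangle_\gamma^{1/2}=\left(\int_\Gamma|(-\Delta_\Gamma)^{\gamma/2}\boldsymbol b|^2\,d\Gamma\right)^{1/2}.$$ Let $G(\boldsymbol x,\boldsymbol y)=\frac{1}{4\pi|\boldsymbol x-\boldsymbol y|}$, so $\nabla_{\boldsymbol x}G(\boldsymbol x,\boldsymbol y)=-\frac{\boldsymbol x-\boldsymbol y}{4\pi|\boldsymbol x-\boldsymbol y|^3}$. For $\boldsymbol y,\boldsymbol z\in B_R$ and $\boldsymbol\alpha,\boldsymbol\beta\in S$, the point spread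 function with parameter $\gamma$ is $$K_{(\boldsymbol y,\boldsymbol\alpha)}(\boldsymbol z,\boldsymbol\beta):=\frac{\langle\nabla_{\boldsymbol x}G(\cdot,\boldsymbol y)\times\boldsymbol\alpha,\ \nabla_{\boldsymbol x}G(\cdot,\boldsymbol z)\times\boldsymbol\beta\rangle_\gamma}{|\nabla_{\boldsymbol x}G(\cdot,\boldsymbol z)\times\boldsymbol\beta|_\gamma},$$ where the functions are regarded as functions of $\boldsymbol x\in\Gamma$ and $\Delta_\Gamma$ acts in $\boldsymbol x$. (The denominator is nonzero.) *)

(* Defs.v *)
From Stdlib Require Import Reals.
From Coquelicot Require Import Coquelicot.
Open Scope R_scope.

Definition R3 : Type := (R * R * R)%type.
Definition C3 : Type := (C * C * C)%type.

Definition norm3 (x : R3) : R :=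
  let '(x1, x2, x3) := x in sqrt (x1 ^ 2 + x2 ^ 2 + x3 ^ 2).

Definition sub3 (x y : R3) : R3 :=
  let '(x1, x2, x3) := x in let '(y1, y2, y3) := y in
  (x1 - y1, x2 - y2, x3 - y3).

(* Bilinear: the second argument is not conjugated. *)
Definition cdot (u v : C3) : C :=
  let '(u1, u2, u3) := u in let '(v1, v2, v3) := v in
  (u1 * v1 + u2 * v2 + u3 * v3)%C.

Definition cconj (u : C3) : C3 :=
  let '(u1, u2, u3) := u in (Cconj u1, Cconj u2, Cconj u3).

Definition ccross (u v : C3) : C3 :=
  let '(u1, u2, u3) := u in let '(v1, v2, v3) := v in
  (u2 * v3 - u3 * v2, u3 * v1 - u1 * v3, u1 * v2 - u2 * v1)%C.

Definition cnorm (u : C3) : R :=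
  let '(u1, u2, u3) := u in
  sqrt (Cmod u1 ^ 2 + Cmod u2 ^ 2 + Cmod u3 ^ 2).

(* Derivative of a complex-valued function of a real variable. *)
Definition CDerive (f : R -> C) (t : R) : C :=
  (Derive (fun s => Re (f s)) t, Derive (fun s => Im (f s)) t).

Definition partial1 (f : R3 -> C) (x : R3) : C :=
  let '(x1, x2, x3) := x in CDerive (fun t => f (t, x2, x3)) x1.
Definition partial2 (f : R3 -> C) (x : R3) : C :=
  let '(x1, x2, x3) := x in CDerive (fun t => f (x1, t, x3)) x2.
Definition partial3 (f : R3 -> C) (x : R3) : C :=
  let '(x1, x2, x3) := x in CDerive (fun t => f (x1, x2, t)) x3.

Definition grad (f : R3 -> C) (x : R3) : C3 :=
  (partial1 f x, partial2 f x, partial3 f x).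

Definition comp1 (v : R3 -> C3) (x : R3) : C := let '(v1, _, _) := v x in v1.
Definition comp2 (v : R3 -> C3) (x : R3) : C := let '(_, v2, _) := v x in v2.
Definition comp3 (v : R3 -> C3) (x : R3) : C := let '(_, _, v3) := v x in v3.

Definition divergence (v : R3 -> C3) (x : R3) : C :=
  (partial1 (comp1 v) x + partial2 (comp2 v) x + partial3 (comp3 v) x)%C.

(* Functions on the sphere of radius rad are represented by functions on R3;
   every operator below depends only on their values on the sphere, and its
   result is meaningful at points of the sphere. *)

(* Nearest-point projection of R3 minus the origin onto the sphere;
   composing with it extends a function constantly along the normals. *)
Definition sphere_proj (rad : R) (x : R3) : R3 :=
  let '(x1, x2, x3) := x in
  (rad / norm3 x * x1, rad / norm3 x * x2, rad / norm3 x * x3).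

(* For fields constant along the normals, the Euclidean gradient and
   divergence coincide on the sphere with the surface ones. *)
Definition surf_grad (rad : R) (f : R3 -> C) (x : R3) : C3 :=
  grad (fun p => f (sphere_proj rad p)) x.
Definition surf_div (rad : R) (v : R3 -> C3) (x : R3) : C :=
  divergence (fun p => v (sphere_proj rad p)) x.

Definition laplace_beltrami (rad : R) (f : R3 -> C) : R3 -> C :=
  surf_div rad (surf_grad rad f).

Definition neg_laplace_beltrami3 (rad : R) (v : R3 -> C3) (x : R3) : C3 :=
  ((- laplace_beltrami rad (comp1 v) x)%C,
   (- laplace_beltrami rad (comp2 v) x)%C,
   (- laplace_beltrami rad (comp3 v) x)%C).

Definition neg_laplace_beltrami3_pow (rad : R) (gamma : nat) (v : R3 -> C3)
  : R3 -> C3 :=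
  Nat.iter gamma (neg_laplace_beltrami3 rad) v.

(* Surface integral in spherical coordinates, with surface element
   rad^2 sin theta dphi dtheta. *)
Definition surf_RInt (rad : R) (f : R3 -> R) : R :=
  RInt (fun theta =>
    RInt (fun phi =>
      f (rad * sin theta * cos phi, rad * sin theta * sin phi, rad * cos theta)
      * (rad ^ 2 * sin theta)) 0 (2 * PI)) 0 PI.

Definition surf_CInt (rad : R) (f : R3 -> C) : C :=
  (surf_RInt rad (fun x => Re (f x)), surf_RInt rad (fun x => Im (f x))).

Definition inner_gamma (rad : R) (gamma : nat) (a b : R3 -> C3) : C :=
  surf_CInt rad (fun x =>
    cdot (a x) (cconj (neg_laplace_beltrami3_pow rad gamma b x))).

(* The inner product of b with itself is real and nonnegative for smooth b,
   so taking its real part loses nothing. *)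
Definition norm_gamma (rad : R) (gamma : nat) (b : R3 -> C3) : R :=
  sqrt (Re (inner_gamma rad gamma b b)).

Definition G (x y : R3) : R := 1 / (4 * PI * norm3 (sub3 x y)).

Definition gradG (y x : R3) : C3 := grad (fun p => RtoC (G p y)) x.

Definition psf (rad : R) (gamma : nat) (y : R3) (alpha : C3) (z : R3)
    (beta : C3) : C :=
  (inner_gamma rad gamma (fun x => ccross (gradG y x) alpha)
                         (fun x => ccross (gradG z x) beta)
   / RtoC (norm_gamma rad gamma (fun x => ccross (gradG z x) beta)))%C.

Definition D2 (rad : R) (z : R3) : R :=
  (rad ^ 6 + 12 * rad ^ 4 * norm3 z ^ 2 + 15 * rad ^ 2 * norm3 z ^ 4
   + 2 * norm3 z ^ 6) / (PI * (rad ^ 2 - norm3 z ^ 2) ^ 6).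

(* Main.v *)
Require Import Defs.
From Stdlib Require Import Reals Lra Psatz ssreflect.
From Coquelicot Require Import Coquelicot.
Open Scope R_scope.

(** On the sphere, the [x]-gradient of the [l]-th term of the multipole expansion
of [1 / (4 pi |x - z|)] is a spherical harmonic of degree [l + 1].  For [y = 0]
the first argument of the inner product is of degree 1, an eigenvector of
[Delta^2], and pairs only with the part [- x / (4 pi rad^3)] of the second
gradient, which does not depend on [z]; hence the numerator is a constant
multiple of [alpha . conj beta].  The squared denominator is the integral of
[|Delta (grad G) x beta|^2].  It is at most a multiple of the integral of
[|x - z|^(-8)], and by azimuthal averaging around [z] at least an explicit
rational function of [|z|]; both, like [D2], are comparable to
[rad^6 / (rad^2 - |z|^2)^6].

All integrals come from the divergence theorem on the sphere: an integrand is
written as a constant plus the surface divergence of an explicit field.  To make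
such certificates checkable by [field], integrands are symbolic expressions. *)

(** The multipole series explains why the numerator does not depend on [z], but it is never formed:
    its one consequence is the closed-form integral [J_Lin_dipole], so no termwise integration
    occurs. The price is odd moments of [q = 1 / |x - z|], whose certificates have removable
    singularities on the axis of [z]; [Ie] is the generator that expresses them after division.

    On the sphere [|x - z|^2] is the affine function [dist2]. With it, the gradient of any function
    of the distance is a multiple of [z], and tangential calculus becomes algebra in [q].

    The denominator needs the exact power of [rad^2 - |z|^2]. From above this rests on a
    cancellation: the parts of [Delta (grad G)] along [x] and along [z] can each reach the order
    [q^5], and a bound of that order would lose two powers after squaring and integrating. From
    below, the field is tested against a direction orthogonal to [z], where only the coefficient of
    [x] survives. *)

Definition dot (u v : R3) : R :=
  let '(u1, u2, u3) := u in let '(v1, v2, v3) := v in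
  u1 * v1 + u2 * v2 + u3 * v3.

(* On the sphere, [Qe] is [1 / |x - z|] and [Ie] is
   [1 / ((|x - z| + rad)^2 - |z|^2)]. *)
Inductive expr : Type :=
| Cst (c : R)
| Lin (e : R3)
| Qe
| Ie
| Add (f g : expr)
| Mul (f g : expr).

Section Sphere.

Variables (rad : R) (z : R3).
Hypothesis rad_pos : 0 < rad.
Hypothesis z_in_ball : dot z z < rad ^ 2.

Definition on_sphere (x : R3) : Prop := dot x x = rad ^ 2.

(* This equals [|x - z|^2] only on the sphere. *)
Definition dist2 (x : R3) : R := rad ^ 2 + dot z z - 2 * dot z x.

Fixpoint eval (e : expr) (x : R3) : R :=
  match e with
  | Cst c => c
  | Lin v => dot v x
  | Qe => / sqrt (dist2 x)
  | Ie => / ((sqrt (dist2 x) + rad) ^ 2 - dot z z)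
  | Add f g => eval f x + eval g x
  | Mul f g => eval f x * eval g x
  end.

(* Directional derivative along [v], valid at points of the sphere. *)
Fixpoint D (v : R3) (e : expr) : expr :=
  match e with
  | Cst _ => Cst 0
  | Lin e => Cst (dot e v)
  | Qe => Mul (Cst (dot z v)) (Mul Qe (Mul Qe Qe))
  | Ie => Mul (Cst (2 * dot z v))
            (Mul (Add (Cst 1) (Mul (Cst rad) Qe)) (Mul Ie Ie))
  | Add f g => Add (D v f) (D v g)
  | Mul f g => Add (Mul (D v f) g) (Mul f (D v g))
  end.

Lemma dist2_pos (x : R3) : on_sphere x -> 0 < dist2 x.
Proof.
  unfold on_sphere, dist2; intros Hx.
  destruct x as [[x1 x2] x3], z as [[z1 z2] z3]; cbn [dot] in *.
  destruct (Rle_lt_dec ((x1 - z1) ^ 2 + (x2 - z2) ^ 2 + (x3 - z3) ^ 2) 0); [|nra].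
  pose proof (pow2_ge_0 (x1 - z1)); pose proof (pow2_ge_0 (x2 - z2)).
  pose proof (pow2_ge_0 (x3 - z3)).
  assert (x1 - z1 = 0) by (apply Rsqr_0_uniq; unfold Rsqr; lra).
  assert (x2 - z2 = 0) by (apply Rsqr_0_uniq; unfold Rsqr; lra).
  assert (x3 - z3 = 0) by (apply Rsqr_0_uniq; unfold Rsqr; lra).
  replace x1 with z1 in Hx by lra; replace x2 with z2 in Hx by lra.
  replace x3 with z3 in Hx by lra; lra.
Qed.

Lemma Ie_denominator_pos (x : R3) :
  0 < (sqrt (dist2 x) + rad) ^ 2 - dot z z.
Proof. pose proof (sqrt_pos (dist2 x)); nra. Qed.

Lemma is_derive_inv_sqrt (l : R -> R) (t k : R) :
  0 < l t -> is_derive l t (- 2 * k) ->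
  is_derive (fun u => / sqrt (l u)) t
    (k * (/ sqrt (l t) * (/ sqrt (l t) * / sqrt (l t)))).
Proof.
  intros Hp Hl.
  assert (Hq : 0 < sqrt (l t)) by now apply sqrt_lt_R0.
  auto_derive; [repeat split; try lra; eexists; eassumption|].
  change (Derive (fun x => l x) t) with (Derive l t).
  rewrite (is_derive_unique l t _ Hl); field; lra.
Qed.

Lemma is_derive_inv_shifted_sqrt (l : R -> R) (t k r m : R) :
  0 < l t -> 0 < (sqrt (l t) + r) ^ 2 - m -> is_derive l t (- 2 * k) ->
  is_derive (fun u => / ((sqrt (l u) + r) ^ 2 - m)) t
    (2 * k * ((1 + r * / sqrt (l t)) *
       (/ ((sqrt (l t) + r) ^ 2 - m) * / ((sqrt (l t) + r) ^ 2 - m)))).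
Proof.
  intros Hp Hd Hl.
  assert (Hq : 0 < sqrt (l t)) by now apply sqrt_lt_R0.
  auto_derive; [repeat split; try lra; eexists; eassumption|].
  change (Derive (fun x => l x) t) with (Derive l t).
  rewrite (is_derive_unique l t _ Hl); field; lra.
Qed.

Lemma is_derive_dot_curve (v : R3) (c1 c2 c3 : R -> R) (t d1 d2 d3 : R) :
  is_derive c1 t d1 -> is_derive c2 t d2 -> is_derive c3 t d3 ->
  is_derive (fun u => dot v (c1 u, c2 u, c3 u)) t (dot v (d1, d2, d3)).
Proof.
  intros H1 H2 H3; destruct v as [[v1 v2] v3]; cbn [dot].
  apply: is_derive_plus; [apply: is_derive_plus|]; now apply: is_derive_scal.
Qed.

(** A general curve serves both later uses: the coordinate lines of the sphere, and curves projected
    radially onto it. Only the point at time [t] has to lie on the sphere, where [dist2] is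
    positive. *)
Lemma is_derive_eval_curve (e : expr) (c1 c2 c3 : R -> R) (t d1 d2 d3 : R) :
  is_derive c1 t d1 -> is_derive c2 t d2 -> is_derive c3 t d3 ->
  on_sphere (c1 t, c2 t, c3 t) ->
  is_derive (fun u => eval e (c1 u, c2 u, c3 u)) t
    (eval (D (d1, d2, d3) e) (c1 t, c2 t, c3 t)).
Proof.
  intros H1 H2 H3 Hs.
  assert (Hd : is_derive (fun u => dist2 (c1 u, c2 u, c3 u)) t
                 (- 2 * dot z (d1, d2, d3))).
  { unfold dist2.
    replace (-2 * dot z (d1, d2, d3)) with (0 - 2 * dot z (d1, d2, d3)) by ring.
    apply: is_derive_minus; [apply: is_derive_const|].
    apply: is_derive_scal; now apply is_derive_dot_curve. }
  pose proof (dist2_pos _ Hs) as Hp.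
  induction e as [c|v| | |f IHf g IHg|f IHf g IHg]; cbn [eval D].
  - apply: is_derive_const.
  - now apply is_derive_dot_curve.
  - exact (is_derive_inv_sqrt (fun u => dist2 (c1 u, c2 u, c3 u)) t _ Hp Hd).
  - exact (is_derive_inv_shifted_sqrt (fun u => dist2 (c1 u, c2 u, c3 u)) t _ _ _
             Hp (Ie_denominator_pos _) Hd).
  - apply: is_derive_plus; assumption.
  - apply: (is_derive_mult (fun u => eval f (c1 u, c2 u, c3 u))); try assumption.
    intros; apply Rmult_comm.
Qed.

(** * Spherical coordinates *)

Definition sph (th ph : R) : R3 :=
  (rad * sin th * cos ph, rad * sin th * sin ph, rad * cos th).

Lemma on_sphere_sph (th ph : R) : on_sphere (sph th ph).
Proof.
  unfold on_sphere, sph; cbn [dot].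
  pose proof (sin2_cos2 th) as H1; pose proof (sin2_cos2 ph) as H2.
  unfold Rsqr in *.
  replace (rad * sin th * cos ph * (rad * sin th * cos ph) +
    rad * sin th * sin ph * (rad * sin th * sin ph) +
    rad * cos th * (rad * cos th)) with
    (rad ^ 2 * (sin th * sin th * (sin ph * sin ph + cos ph * cos ph) +
       cos th * cos th)) by ring.
  rewrite H2 Rmult_1_r H1; ring.
Qed.

Lemma continuity_2d_pt_sin1 (x y : R) : continuity_2d_pt (fun u _ => sin u) x y.
Proof.
  apply continuity_1d_2d_pt_comp;
    [apply continuity_sin | apply continuity_2d_pt_id1].
Qed.

Lemma continuity_2d_pt_cos1 (x y : R) : continuity_2d_pt (fun u _ => cos u) x y.
Proof.
  apply continuity_1d_2d_pt_comp;
    [apply continuity_cos | apply continuity_2d_pt_id1].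
Qed.

Lemma continuity_2d_pt_sin2 (x y : R) : continuity_2d_pt (fun _ v => sin v) x y.
Proof.
  apply (continuity_1d_2d_pt_comp sin (fun _ v => v));
    [apply continuity_sin | apply continuity_2d_pt_id2].
Qed.

Lemma continuity_2d_pt_cos2 (x y : R) : continuity_2d_pt (fun _ v => cos v) x y.
Proof.
  apply (continuity_1d_2d_pt_comp cos (fun _ v => v));
    [apply continuity_cos | apply continuity_2d_pt_id2].
Qed.

Ltac cont2d :=
  repeat first
    [ assumption
    | apply continuity_2d_pt_const
    | apply continuity_2d_pt_sin1 | apply continuity_2d_pt_cos1
    | apply continuity_2d_pt_sin2 | apply continuity_2d_pt_cos2
    | apply continuity_2d_pt_plus | apply continuity_2d_pt_minus
    | apply continuity_2d_pt_mult | apply continuity_2d_pt_opp ].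

Lemma continuity_2d_pt_dot_sph (v : R3) (x y : R) :
  continuity_2d_pt (fun th ph => dot v (sph th ph)) x y.
Proof. destruct v as [[v1 v2] v3]; unfold sph; cbn [dot]; cont2d. Qed.

Lemma continuity_2d_pt_eval_sph (e : expr) (x y : R) :
  continuity_2d_pt (fun th ph => eval e (sph th ph)) x y.
Proof.
  pose proof (dist2_pos _ (on_sphere_sph x y)) as Hp.
  assert (Hs : continuity_2d_pt (fun th ph => sqrt (dist2 (sph th ph))) x y).
  { apply (continuity_1d_2d_pt_comp sqrt (fun th ph => dist2 (sph th ph))).
    - apply continuity_pt_sqrt; lra.
    - unfold dist2; cont2d; apply continuity_2d_pt_dot_sph. }
  induction e as [c|v| | |f IHf g IHg|f IHf g IHg]; cbn [eval].
  - apply continuity_2d_pt_const.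
  - apply continuity_2d_pt_dot_sph.
  - apply continuity_2d_pt_inv; [assumption|].
    apply Rgt_not_eq, sqrt_lt_R0, Hp.
  - apply continuity_2d_pt_inv.
    + cbn [pow]; cont2d.
    + apply Rgt_not_eq, Ie_denominator_pos.
  - now apply continuity_2d_pt_plus.
  - now apply continuity_2d_pt_mult.
Qed.


Lemma continuous_slice (f : R -> R -> R) (x y : R) :
  continuity_2d_pt f x y -> continuous (f x) y.
Proof.
  intros H P [eps HP].
  destruct (H eps) as [d Hd]; exists d; intros v Hv; apply HP.
  apply Hd; [rewrite Rminus_diag_eq // Rabs_R0; apply cond_pos|exact Hv].
Qed.

Lemma ex_RInt_slice (f : R -> R -> R) (x a b : R) :
  (forall y, continuity_2d_pt f x y) -> ex_RInt (f x) a b.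
Proof.
  intros H; apply: ex_RInt_continuous => y _; now apply continuous_slice.
Qed.

Lemma is_derive_RInt_slice (f f' : R -> R -> R) (a b x : R) :
  (forall u v, continuity_2d_pt f u v) ->
  (forall u v, continuity_2d_pt f' u v) ->
  (forall u v, is_derive (fun w => f w v) u (f' u v)) ->
  is_derive (fun u => RInt (f u) a b) x (RInt (f' x) a b).
Proof.
  intros Hf Hf' Hd.
  assert (HD : forall u v, Derive (fun w => f w v) u = f' u v)
    by (intros; now apply is_derive_unique).
  rewrite -(RInt_ext (fun v => Derive (fun w => f w v) x)); [|now intros].
  apply is_derive_RInt_param.
  - apply filter_forall => u v _; eexists; apply Hd.
  - intros v _; apply (continuity_2d_pt_ext f'); [now intros|apply Hf'].
  - apply filter_forall => u; now apply ex_RInt_slice.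
Qed.

(** * Surface integrals and the divergence theorem *)

Definition surf_density (f : R3 -> R) (th ph : R) : R :=
  f (sph th ph) * (rad ^ 2 * sin th).

Lemma continuity_2d_pt_surf_density (e : expr) (x y : R) :
  continuity_2d_pt (surf_density (eval e)) x y.
Proof. unfold surf_density; cont2d; apply continuity_2d_pt_eval_sph. Qed.

Definition sph_th (th ph : R) : R3 :=
  (rad * cos th * cos ph, rad * cos th * sin ph, - (rad * sin th)).

Definition sph_ph (th ph : R) : R3 :=
  (- (rad * sin th * sin ph), rad * sin th * cos ph, 0).

Lemma is_derive_eval_th (e : expr) (th ph : R) :
  is_derive (fun u => eval e (sph u ph)) th
    (eval (D (sph_th th ph) e) (sph th ph)).
Proof.
  apply (is_derive_eval_curve e (fun u => rad * sin u * cos ph)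
    (fun u => rad * sin u * sin ph) (fun u => rad * cos u));
    [auto_derive; [trivial|ring] ..|apply on_sphere_sph].
Qed.

Lemma is_derive_eval_ph (e : expr) (th ph : R) :
  is_derive (fun u => eval e (sph th u)) ph
    (eval (D (sph_ph th ph) e) (sph th ph)).
Proof.
  apply (is_derive_eval_curve e (fun u => rad * sin th * cos u)
    (fun u => rad * sin th * sin u) (fun _ => rad * cos th));
    [auto_derive; [trivial|ring] ..|apply on_sphere_sph].
Qed.

Lemma dot_comm (u v : R3) : dot u v = dot v u.
Proof. destruct u as [[? ?] ?], v as [[? ?] ?]; cbn [dot]; ring. Qed.

Lemma eval_D_linear (v : R3) (e : expr) (x : R3) :
  eval (D v e) x =
    dot v (eval (D (1, 0, 0) e) x, eval (D (0, 1, 0) e) x, eval (D (0, 0, 1) e) x).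
Proof.
  destruct v as [[v1 v2] v3].
  induction e as [c|w| | |f IHf g IHg|f IHf g IHg]; cbn [eval D];
    try (rewrite IHf IHg); generalize z; intros [[z1 z2] z3]; cbn [dot]; try ring.
  destruct w as [[w1 w2] w3]; cbn [dot]; ring.
Qed.

Definition e1 : R3 := (1, 0, 0).
Definition e2 : R3 := (0, 1, 0).
Definition e3 : R3 := (0, 0, 1).

(** [D] takes a constant direction, so the derivative along the position vector is spelled out in
    coordinates to be an [expr] again. *)
Definition Euler (e : expr) : expr :=
  Add (Mul (Lin e1) (D e1 e)) (Add (Mul (Lin e2) (D e2 e)) (Mul (Lin e3) (D e3 e))).

Lemma eval_Euler (e : expr) (x : R3) : eval (Euler e) x = eval (D x e) x.
Proof.
  rewrite (eval_D_linear x); unfold Euler; cbn [eval].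
  destruct x as [[x1 x2] x3]; unfold e1, e2, e3; cbn [dot]; ring.
Qed.

(* On the sphere this is the surface divergence of the tangential part of the
   field [x |-> e x * v]. *)
Definition sdiv (v : R3) (e : expr) : expr :=
  Add (D v e)
    (Mul (Cst (- / rad ^ 2))
       (Mul (Lin v) (Add (Mul (Cst 2) e) (Euler e)))).

Lemma eval_sdiv (v : R3) (e : expr) (x : R3) :
  eval (sdiv v e) x =
    eval (D v e) x - dot v x / rad ^ 2 * (2 * eval e x + eval (D x e) x).
Proof. unfold sdiv; cbn [eval]; rewrite eval_Euler; field; lra. Qed.

Lemma continuity_2d_pt_eval_D_sph (v : R -> R -> R3) (e : expr) (x y : R) :
  (forall w, continuity_2d_pt (fun th ph => dot w (v th ph)) x y) ->
  continuity_2d_pt (fun th ph => eval (D (v th ph) e) (sph th ph)) x y.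
Proof.
  intros H.
  apply (continuity_2d_pt_ext (fun th ph =>
    dot e1 (v th ph) * eval (D e1 e) (sph th ph) +
    dot e2 (v th ph) * eval (D e2 e) (sph th ph) +
    dot e3 (v th ph) * eval (D e3 e) (sph th ph))).
  - intros th ph; rewrite (eval_D_linear (v th ph)).
    destruct (v th ph) as [[v1 v2] v3]; unfold e1, e2, e3; cbn [dot]; ring.
  - cont2d; try apply H; apply continuity_2d_pt_eval_sph.
Qed.

(* [rad^2 sin th] times the surface divergence splits into a [th]- and a
   [ph]-derivative, both of smooth functions. *)
Definition sdiv_th (v : R3) (e : expr) (th ph : R) : R :=
  (- dot v (sph th ph) * eval e (sph th ph)
   + dot v (sph_th th ph) * eval (D (sph_th th ph) e) (sph th ph)) * sin th
  + dot v (sph_th th ph) * eval e (sph th ph) * cos th.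

Definition sdiv_ph (v : R3) (e : expr) (th ph : R) : R :=
  rad * dot v (- cos ph, - sin ph, 0) * eval e (sph th ph)
  + rad * dot v (- sin ph, cos ph, 0) * eval (D (sph_ph th ph) e) (sph th ph).

Lemma surf_density_sdiv (v : R3) (e : expr) (th ph : R) :
  surf_density (eval (sdiv v e)) th ph = sdiv_th v e th ph + sdiv_ph v e th ph.
Proof.
  unfold surf_density, sdiv_th, sdiv_ph; rewrite eval_sdiv.
  rewrite (eval_D_linear v) (eval_D_linear (sph_th th ph))
    (eval_D_linear (sph_ph th ph)) (eval_D_linear (sph th ph)).
  set (d1 := eval (D (1, 0, 0) e) _); set (d2 := eval (D (0, 1, 0) e) _).
  set (d3 := eval (D (0, 0, 1) e) _); set (e0 := eval e _).
  clearbody d1 d2 d3 e0.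
  destruct v as [[v1 v2] v3]; unfold sph, sph_th, sph_ph; cbn [dot].
  pose proof (sin2_cos2 th) as Hs1; pose proof (sin2_cos2 ph) as Hs2.
  unfold Rsqr in *.
  set (S := sin th) in *; set (K := cos th) in *.
  set (s := sin ph) in *; set (k := cos ph) in *.
  assert (HK : K * K = 1 - S * S) by lra.
  assert (Hk : k * k = 1 - s * s) by lra.
  field_simplify_eq; [|lra].
  ring [HK Hk].
Qed.

Lemma is_derive_sdiv_th (v : R3) (e : expr) (th ph : R) :
  is_derive (fun u => dot v (sph_th u ph) * eval e (sph u ph) * sin u) th
    (sdiv_th v e th ph).
Proof.
  apply: is_derive_mult; [|apply: is_derive_sin|intros; apply Rmult_comm].
  apply: is_derive_mult;
    [|apply is_derive_eval_th|intros; apply Rmult_comm].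
  destruct v as [[v1 v2] v3]; unfold sph, sph_th; cbn [dot].
  auto_derive; [trivial|ring].
Qed.

(** The divergence in spherical coordinates divides the azimuthal component by [sin th]. This
    cancels the factor [sin th] of [sph_ph], so the primitive is smooth at the poles. *)
Lemma is_derive_sdiv_ph (v : R3) (e : expr) (th ph : R) :
  is_derive (fun w => rad * dot v (- sin w, cos w, 0) * eval e (sph th w)) ph
    (sdiv_ph v e th ph).
Proof.
  apply: is_derive_mult;
    [|apply is_derive_eval_ph|intros; apply Rmult_comm].
  destruct v as [[v1 v2] v3]; cbn [dot]; auto_derive; [trivial|ring].
Qed.

Lemma continuity_2d_pt_dot_sph_th (v : R3) (x y : R) :
  continuity_2d_pt (fun th ph => dot v (sph_th th ph)) x y.
Proof. destruct v as [[v1 v2] v3]; unfold sph_th; cbn [dot]; cont2d. Qed.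

Lemma continuity_2d_pt_sdiv_th (v : R3) (e : expr) (x y : R) :
  continuity_2d_pt (sdiv_th v e) x y.
Proof.
  unfold sdiv_th; cont2d;
    first [ apply continuity_2d_pt_dot_sph | apply continuity_2d_pt_eval_sph
          | apply continuity_2d_pt_dot_sph_th
          | apply continuity_2d_pt_eval_D_sph; intros;
            apply continuity_2d_pt_dot_sph_th ].
Qed.

Lemma continuity_2d_pt_sdiv_ph (v : R3) (e : expr) (x y : R) :
  continuity_2d_pt (sdiv_ph v e) x y.
Proof.
  unfold sdiv_ph; cont2d;
    first [ apply continuity_2d_pt_eval_sph
          | apply continuity_2d_pt_eval_D_sph; intros [[w1 w2] w3];
            unfold sph_ph; cbn [dot]; cont2d
          | destruct v as [[v1 v2] v3]; cbn [dot]; cont2d ].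
Qed.

Lemma surf_RInt_density (f : R3 -> R) :
  surf_RInt rad f = RInt (fun th => RInt (surf_density f th) 0 (2 * PI)) 0 PI.
Proof. reflexivity. Qed.

Lemma ex_derive_inner_surf_RInt (e : expr) (th : R) :
  ex_derive (fun u => RInt (surf_density (eval e) u) 0 (2 * PI)) th.
Proof.
  exists (RInt (fun ph => eval (D (sph_th th ph) e) (sph th ph) * (rad ^ 2 * sin th)
    + eval e (sph th ph) * (rad ^ 2 * cos th)) 0 (2 * PI)).
  apply (is_derive_RInt_slice (surf_density (eval e)) (fun th ph =>
    eval (D (sph_th th ph) e) (sph th ph) * (rad ^ 2 * sin th)
    + eval e (sph th ph) * (rad ^ 2 * cos th))); intros u v.
  - apply continuity_2d_pt_surf_density.
  - cont2d; [|apply continuity_2d_pt_eval_sph].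
    apply continuity_2d_pt_eval_D_sph; intros; apply continuity_2d_pt_dot_sph_th.
  - apply: is_derive_mult; [apply is_derive_eval_th| |intros; apply Rmult_comm].
    apply: is_derive_scal; apply: is_derive_sin.
Qed.

Lemma ex_RInt_surf_density (e : expr) (th a b : R) :
  ex_RInt (surf_density (eval e) th) a b.
Proof. apply ex_RInt_slice; intros; apply continuity_2d_pt_surf_density. Qed.

Lemma ex_RInt_inner_surf_RInt (e : expr) (a b : R) :
  ex_RInt (fun th => RInt (surf_density (eval e) th) 0 (2 * PI)) a b.
Proof.
  apply: ex_RInt_continuous => th _.
  apply: ex_derive_continuous; apply ex_derive_inner_surf_RInt.
Qed.

Lemma surf_RInt_ext (f g : R3 -> R) :
  (forall x, on_sphere x -> f x = g x) -> surf_RInt rad f = surf_RInt rad g.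
Proof.
  intros H; rewrite !surf_RInt_density.
  apply RInt_ext => th _; apply RInt_ext => ph _.
  unfold surf_density; rewrite H //; apply on_sphere_sph.
Qed.

Lemma surf_RInt_plus (f g : expr) :
  surf_RInt rad (eval (Add f g)) =
    surf_RInt rad (eval f) + surf_RInt rad (eval g).
Proof.
  rewrite !surf_RInt_density.
  refine (eq_trans _ (RInt_plus _ _ _ _ (ex_RInt_inner_surf_RInt f _ _)
                        (ex_RInt_inner_surf_RInt g _ _))).
  apply RInt_ext => th _.
  refine (eq_trans _ (RInt_plus _ _ _ _ (ex_RInt_surf_density f th _ _)
                        (ex_RInt_surf_density g th _ _))).
  apply RInt_ext => ph _; exact: Rmult_plus_distr_r.
Qed.

Lemma surf_RInt_scal (c : R) (f : expr) :
  surf_RInt rad (eval (Mul (Cst c) f)) = c * surf_RInt rad (eval f).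
Proof.
  rewrite !surf_RInt_density.
  refine (eq_trans _ (RInt_scal _ _ _ c (ex_RInt_inner_surf_RInt f _ _))).
  apply RInt_ext => th _.
  refine (eq_trans _ (RInt_scal _ _ _ c (ex_RInt_surf_density f th _ _))).
  apply RInt_ext => ph _; exact: Rmult_assoc.
Qed.

Lemma surf_RInt_le (f g : expr) :
  (forall x, on_sphere x -> eval f x <= eval g x) ->
  surf_RInt rad (eval f) <= surf_RInt rad (eval g).
Proof.
  intros H; rewrite !surf_RInt_density.
  pose proof PI_RGT_0.
  apply RInt_le; try apply ex_RInt_inner_surf_RInt; [lra|]; intros th Hth.
  apply RInt_le; try apply ex_RInt_surf_density; [lra|]; intros ph _.
  apply Rmult_le_compat_r; [|apply H, on_sphere_sph].
  apply Rmult_le_pos; [apply pow2_ge_0|apply sin_ge_0; lra].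
Qed.

Lemma surf_RInt_const (c : R) :
  surf_RInt rad (fun _ => c) = c * (4 * PI * rad ^ 2).
Proof.
  rewrite surf_RInt_density.
  rewrite (RInt_ext _ (fun th => c * rad ^ 2 * (2 * PI) * sin th)).
  - apply is_RInt_unique.
    replace (c * (4 * PI * rad ^ 2)) with
      (minus (- (c * rad ^ 2 * (2 * PI)) * cos PI)
             (- (c * rad ^ 2 * (2 * PI)) * cos 0)).
    + apply: (is_RInt_derive (fun th => - (c * rad ^ 2 * (2 * PI)) * cos th)).
      * intros th _; auto_derive; [trivial|ring].
      * intros th _; apply: ex_derive_continuous; auto_derive; trivial.
    + rewrite cos_PI cos_0; unfold minus, plus, opp; simpl; ring.
  - intros th _; unfold surf_density; rewrite RInt_const.
    unfold scal; simpl; unfold mult; simpl; ring.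
Qed.

(** The [ph]-derivative integrates to zero by periodicity. The [th]-derivative is taken out of the
    inner integral, and its primitive carries the factor [sin th], which vanishes at both poles. *)
Lemma surf_RInt_sdiv (v : R3) (e : expr) :
  surf_RInt rad (eval (sdiv v e)) = 0.
Proof.
  rewrite surf_RInt_density.
  set (a := fun th ph => dot v (sph_th th ph) * eval e (sph th ph) * sin th).
  assert (Ha : forall u w, continuity_2d_pt a u w).
  { intros u w; unfold a; cont2d;
      [apply continuity_2d_pt_dot_sph_th|apply continuity_2d_pt_eval_sph]. }
  assert (HA : forall th, is_derive (fun u => RInt (a u) 0 (2 * PI)) th
                 (RInt (surf_density (eval (sdiv v e)) th) 0 (2 * PI))).
  { intros th.
    rewrite (RInt_ext _ (fun ph => plus (sdiv_th v e th ph) (sdiv_ph v e th ph)));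
      [|intros; apply surf_density_sdiv].
    rewrite RInt_plus;
      [|apply ex_RInt_slice; intros; apply continuity_2d_pt_sdiv_th
       |apply ex_RInt_slice; intros; apply continuity_2d_pt_sdiv_ph].
    assert (Hb : is_RInt (sdiv_ph v e th) 0 (2 * PI) 0).
    { pose (b := fun w => rad * dot v (- sin w, cos w, 0) * eval e (sph th w)).
      replace 0 with (minus (b (2 * PI)) (b 0)) at 2.
      - apply: is_RInt_derive; intros w _; [apply is_derive_sdiv_ph|].
        apply continuous_slice, continuity_2d_pt_sdiv_ph.
      - unfold b, sph; rewrite sin_2PI cos_2PI sin_0 cos_0; apply: minus_eq_zero. }
    rewrite (is_RInt_unique _ _ _ _ Hb) plus_zero_r.
    apply is_derive_RInt_slice; trivial; intros;
      [apply continuity_2d_pt_sdiv_th|apply is_derive_sdiv_th]. }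
  assert (Hz : forall th, sin th = 0 -> RInt (a th) 0 (2 * PI) = 0).
  { intros th Hth; rewrite (RInt_ext _ (fun _ => 0)).
    - rewrite RInt_const; apply: scal_zero_r.
    - intros; unfold a; rewrite Hth; exact: Rmult_0_r. }
  apply is_RInt_unique.
  replace 0 with (minus (RInt (a PI) 0 (2 * PI)) (RInt (a 0) 0 (2 * PI))) at 2.
  - apply: (is_RInt_derive (fun th => RInt (a th) 0 (2 * PI))); intros th _;
      [apply HA|].
    apply: ex_derive_continuous; apply ex_derive_inner_surf_RInt.
  - rewrite (Hz _ sin_PI) (Hz _ sin_0); apply: minus_eq_zero.
Qed.

(** * The Laplace-Beltrami operator *)

Definition tang (v : R3) (e : expr) : expr :=
  Add (D v e) (Mul (Cst (- / rad ^ 2)) (Mul (Lin v) (Euler e))).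

Lemma eval_tang (v : R3) (e : expr) (x : R3) :
  eval (tang v e) x = eval (D v e) x - dot v x / rad ^ 2 * eval (D x e) x.
Proof. unfold tang; cbn [eval]; rewrite eval_Euler; field; lra. Qed.

Lemma norm3_sqr (x : R3) : norm3 x ^ 2 = dot x x.
Proof.
  destruct x as [[x1 x2] x3]; cbn [norm3 dot].
  rewrite pow2_sqrt; [ring|].
  pose proof (pow2_ge_0 x1); pose proof (pow2_ge_0 x2); pose proof (pow2_ge_0 x3); lra.
Qed.

Lemma norm3_ge0 (x : R3) : 0 <= norm3 x.
Proof. destruct x as [[x1 x2] x3]; apply sqrt_pos. Qed.

Lemma norm3_on_sphere (x : R3) : on_sphere x -> norm3 x = rad.
Proof.
  unfold on_sphere; rewrite -norm3_sqr; intros H.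
  pose proof (norm3_ge0 x); nra.
Qed.

Lemma norm3_pos (x : R3) : 0 < dot x x -> 0 < norm3 x.
Proof. rewrite -norm3_sqr; intros H; pose proof (norm3_ge0 x); nra. Qed.

Lemma on_sphere_proj (x : R3) : 0 < dot x x -> on_sphere (sphere_proj rad x).
Proof.
  intros H; pose proof (norm3_pos x H) as Hn; pose proof (norm3_sqr x) as Hs.
  unfold on_sphere; destruct x as [[x1 x2] x3]; cbn [sphere_proj].
  set (n := norm3 (x1, x2, x3)) in *; cbn [dot] in *.
  field_simplify_eq; [|lra].
  replace (rad ^ 2 * x1 ^ 2 + rad ^ 2 * x2 ^ 2 + rad ^ 2 * x3 ^ 2)
    with (rad ^ 2 * (x1 * x1 + x2 * x2 + x3 * x3)) by ring.
  now rewrite -Hs.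
Qed.

Lemma is_derive_proj_curve (f : R3 -> R) (e : expr) (c1 c2 c3 : R -> R)
    (t d1 d2 d3 : R) :
  (forall x, on_sphere x -> f x = eval e x) ->
  is_derive c1 t d1 -> is_derive c2 t d2 -> is_derive c3 t d3 ->
  on_sphere (c1 t, c2 t, c3 t) ->
  is_derive (fun u => f (sphere_proj rad (c1 u, c2 u, c3 u))) t
    (eval (tang (d1, d2, d3) e) (c1 t, c2 t, c3 t)).
Proof.
  intros Hf H1 H2 H3 Hs.
  set (x := (c1 t, c2 t, c3 t)) in *; set (d := (d1, d2, d3)).
  assert (HN : is_derive (fun u => dot (c1 u, c2 u, c3 u) (c1 u, c2 u, c3 u)) t
                 (2 * dot x d)).
  { unfold x, d; cbn [dot].
    replace (2 * (c1 t * d1 + c2 t * d2 + c3 t * d3)) with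
      (d1 * c1 t + c1 t * d1 + (d2 * c2 t + c2 t * d2) + (d3 * c3 t + c3 t * d3))
      by ring.
    repeat apply: is_derive_plus; apply: is_derive_mult; trivial;
      intros; apply Rmult_comm. }
  (* [f] and [eval e] agree only on the sphere, and [sphere_proj] lands there only off the origin;
     near [t] the curve stays off the origin. *)
  assert (Hpos : locally t (fun u => 0 < dot (c1 u, c2 u, c3 u) (c1 u, c2 u, c3 u))).
  { apply (ex_derive_continuous _ _ (ex_intro _ _ HN) (fun r => 0 < r)).
    apply open_gt; fold x; rewrite Hs; apply pow_lt, rad_pos. }
  apply (is_derive_ext_loc (fun u => eval e (sphere_proj rad (c1 u, c2 u, c3 u)))).
  { move: Hpos; apply filter_imp => u Hu; symmetry; now apply Hf, on_sphere_proj. }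
  assert (Hk : is_derive (fun u => rad / norm3 (c1 u, c2 u, c3 u)) t
                 (- dot x d / rad ^ 2)).
  { apply (is_derive_ext (fun u =>
      rad * / sqrt (dot (c1 u, c2 u, c3 u) (c1 u, c2 u, c3 u)))).
    { intros u; unfold Rdiv; do 2 f_equal; rewrite -norm3_sqr.
      apply sqrt_pow2, norm3_ge0. }
    replace (- dot x d / rad ^ 2) with
      (rad * (- dot x d * (/ sqrt (dot x x) * (/ sqrt (dot x x) * / sqrt (dot x x))))).
    - apply: is_derive_scal.
      apply (is_derive_inv_sqrt (fun u => dot (c1 u, c2 u, c3 u) (c1 u, c2 u, c3 u))).
      + fold x; rewrite Hs; apply pow_lt, rad_pos.
      + replace (-2 * - dot x d) with (2 * dot x d) by ring; exact HN.
    - rewrite Hs (sqrt_pow2 rad); [field|]; lra. }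
  assert (Hx1 : rad / norm3 x = 1) by (rewrite norm3_on_sphere //; field; lra).
  assert (Hc : forall (c : R -> R) dc, is_derive c t dc ->
    is_derive (fun u => rad / norm3 (c1 u, c2 u, c3 u) * c u) t
      (dc - dot x d / rad ^ 2 * c t)).
  { intros c dc Hc.
    replace (dc - dot x d / rad ^ 2 * c t) with
      (- dot x d / rad ^ 2 * c t + rad / norm3 x * dc)
      by (rewrite Hx1; field; lra).
    apply: is_derive_mult; trivial; intros; apply Rmult_comm. }
  pose proof (is_derive_eval_curve e _ _ _ t _ _ _ (Hc c1 d1 H1) (Hc c2 d2 H2)
                (Hc c3 d3 H3)) as H; cbv beta in H.
  fold x in H; rewrite Hx1 !Rmult_1_l in H; fold x in H.
  specialize (H Hs).
  rewrite eval_tang.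
  rewrite (eval_D_linear d) (eval_D_linear x).
  rewrite eval_D_linear in H.
  match type of H with is_derive _ _ ?l => match goal with
    |- is_derive _ _ ?r => replace r with l; [exact H|] end end.
  rewrite (dot_comm d x).
  generalize (dot x d / rad ^ 2); intros k.
  unfold x, d; cbn [dot]; ring.
Qed.

(** The divergence form, to which [surf_RInt_sdiv] applies directly; [eval_LB] identifies it with
    the iterated surface gradient that unfolding [laplace_beltrami] produces. *)
Definition LB (e : expr) : expr :=
  Add (sdiv e1 (D e1 e)) (Add (sdiv e2 (D e2 e)) (sdiv e3 (D e3 e))).

Definition represents (f : R3 -> C) (er ei : expr) : Prop :=
  forall x, on_sphere x -> f x = (eval er x, eval ei x).

Lemma grad_sphere_proj (f : R3 -> C) (er ei : expr) (x : R3) :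
  represents f er ei -> on_sphere x ->
  grad (fun p => f (sphere_proj rad p)) x =
    ((eval (tang e1 er) x, eval (tang e1 ei) x),
     (eval (tang e2 er) x, eval (tang e2 ei) x),
     (eval (tang e3 er) x, eval (tang e3 ei) x)).
Proof.
  intros Hf Hx; destruct x as [[x1 x2] x3].
  assert (Hr : forall x, on_sphere x -> Re (f x) = eval er x)
    by (intros y Hy; now rewrite Hf).
  assert (Hi : forall x, on_sphere x -> Im (f x) = eval ei x)
    by (intros y Hy; now rewrite Hf).
  unfold grad, partial1, partial2, partial3, CDerive.
  repeat f_equal; apply is_derive_unique.
  - apply (is_derive_proj_curve (fun p => Re (f p)) er (fun t => t) (fun _ => x2)
      (fun _ => x3)); trivial; try apply: is_derive_id; apply: is_derive_const.
  - apply (is_derive_proj_curve (fun p => Im (f p)) ei (fun t => t) (fun _ => x2)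
      (fun _ => x3)); trivial; try apply: is_derive_id; apply: is_derive_const.
  - apply (is_derive_proj_curve (fun p => Re (f p)) er (fun _ => x1) (fun t => t)
      (fun _ => x3)); trivial; try apply: is_derive_id; apply: is_derive_const.
  - apply (is_derive_proj_curve (fun p => Im (f p)) ei (fun _ => x1) (fun t => t)
      (fun _ => x3)); trivial; try apply: is_derive_id; apply: is_derive_const.
  - apply (is_derive_proj_curve (fun p => Re (f p)) er (fun _ => x1) (fun _ => x2)
      (fun t => t)); trivial; try apply: is_derive_id; apply: is_derive_const.
  - apply (is_derive_proj_curve (fun p => Im (f p)) ei (fun _ => x1) (fun _ => x2)
      (fun t => t)); trivial; try apply: is_derive_id; apply: is_derive_const.
Qed.

Lemma eval_LB (e : expr) (x : R3) : on_sphere x ->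
  eval (tang e1 (tang e1 e)) x + eval (tang e2 (tang e2 e)) x
    + eval (tang e3 (tang e3 e)) x = eval (LB e) x.
Proof.
  intros Hx; unfold LB; cbn [eval]; rewrite !eval_sdiv !eval_tang.
  rewrite (eval_D_linear x (tang e1 e)) (eval_D_linear x (tang e2 e))
    (eval_D_linear x (tang e3 e)) (eval_D_linear x (D e1 e))
    (eval_D_linear x (D e2 e)) (eval_D_linear x (D e3 e)).
  change (1, 0, 0) with e1; change (0, 1, 0) with e2; change (0, 0, 1) with e3.
  unfold tang, Euler; cbn [D eval].
  set (g1 := eval (D e1 e) x); set (g2 := eval (D e2 e) x).
  set (g3 := eval (D e3 e) x).
  set (h11 := eval (D e1 (D e1 e)) x); set (h12 := eval (D e1 (D e2 e)) x).
  set (h13 := eval (D e1 (D e3 e)) x); set (h21 := eval (D e2 (D e1 e)) x).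
  set (h22 := eval (D e2 (D e2 e)) x); set (h23 := eval (D e2 (D e3 e)) x).
  set (h31 := eval (D e3 (D e1 e)) x); set (h32 := eval (D e3 (D e2 e)) x).
  set (h33 := eval (D e3 (D e3 e)) x).
  clearbody g1 g2 g3 h11 h12 h13 h21 h22 h23 h31 h32 h33.
  unfold on_sphere in Hx; destruct x as [[x1 x2] x3].
  unfold e1, e2, e3; cbn [dot] in *.
  assert (H1 : x1 * x1 = rad ^ 2 - x2 * x2 - x3 * x3) by lra.
  field_simplify_eq; [|lra].
  ring [H1].
Qed.

Lemma laplace_beltrami_represents (f : R3 -> C) (er ei : expr) :
  represents f er ei -> represents (laplace_beltrami rad f) (LB er) (LB ei).
Proof.
  intros Hf x Hx.
  assert (Hv : forall y, on_sphere y -> surf_grad rad f y = _)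
    by (intros y Hy; apply (grad_sphere_proj f er ei y Hf Hy)).
  unfold laplace_beltrami, surf_div, divergence.
  set (v := surf_grad rad f) in *.
  assert (R1 : represents (comp1 v) (tang e1 er) (tang e1 ei))
    by (intros y Hy; unfold comp1; now rewrite Hv).
  assert (R2 : represents (comp2 v) (tang e2 er) (tang e2 ei))
    by (intros y Hy; unfold comp2; now rewrite Hv).
  assert (H3 : represents (comp3 v) (tang e3 er) (tang e3 ei))
    by (intros y Hy; unfold comp3; now rewrite Hv).
  pose proof (f_equal (fun u : C3 => fst (fst u)) (grad_sphere_proj _ _ _ x R1 Hx)) as P1.
  pose proof (f_equal (fun u : C3 => snd (fst u)) (grad_sphere_proj _ _ _ x R2 Hx)) as P2.
  pose proof (f_equal (fun u : C3 => snd u) (grad_sphere_proj _ _ _ x H3 Hx)) as P3.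
  unfold grad in P1, P2, P3; cbn [fst snd] in P1, P2, P3.
  change (comp1 (fun p => v (sphere_proj rad p)))
    with (fun p => comp1 v (sphere_proj rad p)).
  change (comp2 (fun p => v (sphere_proj rad p)))
    with (fun p => comp2 v (sphere_proj rad p)).
  change (comp3 (fun p => v (sphere_proj rad p)))
    with (fun p => comp3 v (sphere_proj rad p)).
  rewrite P1 P2 P3 -!eval_LB //.
Qed.

(* [f LB g - g LB f] is the surface divergence of [f grad g - g grad f]. *)
Lemma LB_symmetric (f g : expr) :
  surf_RInt rad (fun x => eval f x * eval (LB g) x) =
    surf_RInt rad (fun x => eval (LB f) x * eval g x).
Proof.
  set (w v := Add (Mul f (D v g)) (Mul (Cst (-1)) (Mul g (D v f)))).
  assert (H : forall x, on_sphere x ->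
    eval f x * eval (LB g) x = eval (Add (Mul (LB f) g)
      (Add (sdiv e1 (w e1)) (Add (sdiv e2 (w e2)) (sdiv e3 (w e3))))) x).
  { intros x Hx; unfold LB, w; cbn [eval]; rewrite !eval_sdiv; cbn [D eval].
    rewrite (eval_D_linear x f) (eval_D_linear x g)
      (eval_D_linear x (D e1 f)) (eval_D_linear x (D e2 f))
      (eval_D_linear x (D e3 f)) (eval_D_linear x (D e1 g))
      (eval_D_linear x (D e2 g)) (eval_D_linear x (D e3 g)).
    change (1, 0, 0) with e1; change (0, 1, 0) with e2; change (0, 0, 1) with e3.
    generalize (eval (D e1 f) x) (eval (D e2 f) x) (eval (D e3 f) x)
      (eval (D e1 g) x) (eval (D e2 g) x) (eval (D e3 g) x).
    intros.
    destruct x as [[x1 x2] x3]; unfold e1, e2, e3; cbn [dot].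
    field; lra. }
  rewrite (surf_RInt_ext _ _ H) (surf_RInt_plus (Mul (LB f) g)).
  rewrite (surf_RInt_plus (sdiv e1 (w e1))) (surf_RInt_plus (sdiv e2 (w e2))).
  rewrite !surf_RInt_sdiv !Rplus_0_r; reflexivity.
Qed.

(** * Moments of the distance to [z] *)

Notation J f := (surf_RInt rad (eval f)).
Notation m := (dot z z).
Notation area := (4 * PI * rad ^ 2).

(** The common shape of the certificates for single integrals. Azimuthal averaging needs two
    directions, one transverse and one along [z]; the other certificates take a zero second
    field. *)
Lemma J_sdiv (f g e e' : expr) (v v' : R3) :
  (forall x, on_sphere x ->
    eval f x = eval g x + eval (sdiv v e) x + eval (sdiv v' e') x) ->
  J f = J g.
Proof.
  intros H.
  rewrite (surf_RInt_ext (eval f) (eval (Add g (Add (sdiv v e) (sdiv v' e'))))).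
  - rewrite (surf_RInt_plus g) (surf_RInt_plus (sdiv v e)) !surf_RInt_sdiv; ring.
  - intros x Hx; rewrite (H x Hx); cbn [eval]; ring.
Qed.

Fixpoint Qpow (n : nat) : expr :=
  match n with O => Cst 1 | S n => Mul Qe (Qpow n) end.

Lemma eval_Qpow (n : nat) (x : R3) : eval (Qpow n) x = eval Qe x ^ n.
Proof. induction n as [|n IH]; cbn [Qpow eval pow]; [|rewrite IH]; reflexivity. Qed.

Lemma eval_D_Qpow (n : nat) (v x : R3) :
  eval (D v (Qpow n)) x = dot z v * (INR n * eval Qe x ^ (2 + n)).
Proof.
  induction n as [|n IH]; cbn [Qpow D]; [simpl; ring|].
  cbn -[INR] in *; rewrite IH -/(eval (Qpow n) x) eval_Qpow S_INR; cbn; ring.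
Qed.

(** The infinitesimal form of being a function of [dot z x] alone, which is all that invariance
    under rotations around [z] has to provide below. *)
Definition radial (e : expr) : Prop :=
  exists e' : R3 -> R, forall v x, eval (D v e) x = dot z v * e' x.

Lemma radial_Cst (c : R) : radial (Cst c).
Proof. exists (fun _ => 0); intros; cbn; ring. Qed.

Lemma radial_Qpow (n : nat) : radial (Qpow n).
Proof. eexists; intros; apply eval_D_Qpow. Qed.

Lemma radial_Lin : radial (Lin z).
Proof. exists (fun _ => 1); intros; cbn; ring. Qed.

Lemma radial_Add (f g : expr) : radial f -> radial g -> radial (Add f g).
Proof.
  intros [f' Hf] [g' Hg]; exists (fun x => f' x + g' x).
  intros; cbn [D eval]; rewrite Hf Hg; ring.
Qed.

Lemma radial_Mul (f g : expr) : radial f -> radial g -> radial (Mul f g).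
Proof.
  intros [f' Hf] [g' Hg]; exists (fun x => f' x * eval g x + eval f x * g' x).
  intros; cbn [D eval]; rewrite Hf Hg; ring.
Qed.

(* The squared norm of the tangential part of [z]. *)
Definition tan2 : expr :=
  Add (Cst m) (Mul (Cst (- / rad ^ 2)) (Mul (Lin z) (Lin z))).

(* Averaging over rotations around [z], without performing them. *)
Lemma J_azimuth2 (a b : R3) (f : expr) :
  dot z a = 0 -> dot z b = 0 -> m <> 0 -> radial f ->
  J (Mul (Lin a) (Mul (Lin b) f)) =
    dot a b * rad ^ 2 / (2 * m) * J (Mul tan2 f).
Proof.
  intros Ha Hb Hm [f' Hf].
  rewrite -surf_RInt_scal.
  apply (J_sdiv _ _
    (Mul (Cst (- (rad ^ 2 / (2 * m)))) (Mul tan2 (Mul (Lin b) f)))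
    (Mul (Cst (- / (2 * m))) (Mul (Lin z) (Mul (Lin a) (Mul (Lin b) f))))
    a z).
  intros x Hx; rewrite !eval_sdiv; unfold tan2; cbn [D eval]; rewrite !Hf.
  unfold on_sphere in Hx.
  rewrite (dot_comm a z) (dot_comm b z) (dot_comm b a) Ha Hb.
  field; lra.
Qed.

(** Let [w = z × x] be the velocity of the rotation around [z]. It is divergence-free, kills [f],
    and applied twice to [dot a x] gives [- m * dot a x]; hence the integrand is the divergence of
    [- (a . w) f w / m]. The two fields given here are this one resolved along [a] and [z].
    Multiplied by [dot b x / 2] it is the certificate of [J_azimuth2]. *)
Lemma J_azimuth1 (a : R3) (f : expr) :
  dot z a = 0 -> m <> 0 -> radial f -> J (Mul (Lin a) f) = 0.
Proof.
  intros Ha Hm [f' Hf].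
  rewrite (J_sdiv _ (Cst 0)
    (Mul (Cst (- (rad ^ 2 / m))) (Mul tan2 f))
    (Mul (Cst (- / m)) (Mul (Lin z) (Mul (Lin a) f)))
    a z); [rewrite surf_RInt_const; ring|].
  intros x Hx; rewrite !eval_sdiv; unfold tan2; cbn [D eval]; rewrite !Hf.
  unfold on_sphere in Hx.
  rewrite (dot_comm a z) Ha.
  field; lra.
Qed.

Lemma J_Lin2 (a b : R3) :
  J (Mul (Lin a) (Lin b)) = dot a b * rad ^ 2 / 3 * area.
Proof.
  rewrite -surf_RInt_const.
  apply (J_sdiv _ (Cst _) (Mul (Cst (- rad ^ 2 / 3)) (Lin b)) (Cst 0) a z).
  intros x Hx; rewrite !eval_sdiv; cbn [D eval].
  rewrite (dot_comm b a).
  field; lra.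
Qed.

Lemma Qe_pos (x : R3) : on_sphere x -> 0 < eval Qe x.
Proof. intros Hx; apply Rinv_0_lt_compat, sqrt_lt_R0, dist2_pos, Hx. Qed.

Lemma dist2_Qe (x : R3) : on_sphere x -> dist2 x = / eval Qe x ^ 2.
Proof.
  intros Hx; pose proof (dist2_pos x Hx) as H; cbn [eval].
  rewrite pow_inv Rinv_inv pow2_sqrt //; lra.
Qed.

Lemma dot_z_Qe (x : R3) : on_sphere x ->
  dot z x = (rad ^ 2 + m - / eval Qe x ^ 2) / 2.
Proof. intros Hx; rewrite -(dist2_Qe x Hx); unfold dist2; field. Qed.

(** This integrates the surface divergence of [q^(2+j) z]. Since [dot z x] and [tan2] are
    polynomials in [q^(-2)] of degrees one and two, three moments remain. The second moment is a
    logarithm, but its coefficient vanishes both at [j = 0] and at [j = 2], so the even moments from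
    the fourth on are rational. *)
Lemma moment_rec (j : nat) :
  (INR j + 2) * (rad ^ 2 - m) ^ 2 * J (Qpow (4 + j))
    = 2 * (rad ^ 2 + m) * INR j * J (Qpow (2 + j)) - (INR j - 2) * J (Qpow j).
Proof.
  rewrite -!surf_RInt_scal.
  apply Rminus_diag_uniq.
  transitivity (J (Add (Mul (Cst ((INR j + 2) * (rad ^ 2 - m) ^ 2)) (Qpow (4 + j)))
     (Add (Mul (Cst (- (2 * (rad ^ 2 + m) * INR j))) (Qpow (2 + j)))
        (Mul (Cst (INR j - 2)) (Qpow j))))).
  { rewrite !surf_RInt_plus !surf_RInt_scal; ring. }
  rewrite (J_sdiv _ (Cst 0) (Mul (Cst (- 4 * rad ^ 2)) (Qpow (2 + j))) (Cst 0) z z);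
    [rewrite surf_RInt_const; ring|].
  intros x Hx; rewrite !eval_sdiv.
  cbn [eval D]; rewrite !eval_D_Qpow !eval_Qpow (dot_z_Qe x) // plus_INR.
  change (INR 2) with 2.
  pose proof (Qe_pos x Hx) as Hq; revert Hq.
  generalize (eval Qe x); intros q Hq.
  rewrite !pow_add; cbn [pow]; field; lra.
Qed.

Lemma J_Qpow0 : J (Qpow 0) = area.
Proof. rewrite (surf_RInt_const 1); ring. Qed.

Lemma Ie_Qe (x : R3) : on_sphere x ->
  0 < (1 + rad * eval Qe x) ^ 2 - m * eval Qe x ^ 2 /\
  eval Ie x = eval Qe x ^ 2 / ((1 + rad * eval Qe x) ^ 2 - m * eval Qe x ^ 2).
Proof.
  intros Hx; pose proof (Qe_pos x Hx) as Hq.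
  pose proof (Ie_denominator_pos x) as HI.
  assert (Hr : sqrt (dist2 x) = / eval Qe x) by (cbn [eval]; now rewrite Rinv_inv).
  change (eval Ie x) with (/ ((sqrt (dist2 x) + rad) ^ 2 - m)).
  rewrite Hr; rewrite Hr in HI; clear Hr.
  revert Hq HI; generalize (eval Qe x); intros q Hq HI.
  assert (H : ((1 + rad * q) ^ 2 - m * q ^ 2) = ((/ q + rad) ^ 2 - m) * q ^ 2)
    by (field; lra).
  assert (HP : 0 < (1 + rad * q) ^ 2 - m * q ^ 2)
    by (rewrite H; apply Rmult_lt_0_compat; [exact HI|now apply pow_lt]).
  split; [exact HP|field; lra].
Qed.

(* The field [- 2 rad Ie z] is [(rad - |x - z| - (x . z) / rad) / tan2 * z] with
   the removable singularity at the two poles [x = +- rad z / |z|] divided out;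
   the field in [J_Qe3] arises in the same way. *)
Lemma J_Qe : J (Qpow 1) = area / rad.
Proof.
  unfold Rdiv; rewrite Rmult_comm -surf_RInt_const.
  apply (J_sdiv _ (Cst (/ rad)) (Mul (Cst (-2 * rad)) Ie) (Cst 0) z z).
  intros x Hx; rewrite !eval_sdiv; cbn [eval D Qpow].
  change (/ sqrt (dist2 x)) with (eval Qe x).
  change (/ ((sqrt (dist2 x) + rad) ^ 2 - m)) with (eval Ie x).
  destruct (Ie_Qe x Hx) as [HI ->]; rewrite (dot_z_Qe x) //.
  pose proof (Qe_pos x Hx) as Hq; revert Hq HI.
  generalize (eval Qe x); intros q Hq HI.
  field; lra.
Qed.

Lemma J_Qe3 : J (Qpow 3) = area / (rad * (rad ^ 2 - m)).
Proof.
  unfold Rdiv; rewrite Rmult_comm -surf_RInt_const.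
  apply (J_sdiv _ (Cst (/ (rad * (rad ^ 2 - m))))
    (Mul (Cst (- 2 * rad / (rad ^ 2 - m)))
       (Mul (Add (Cst 1) (Mul (Cst (2 * rad)) Qe)) Ie)) (Cst 0) z z).
  intros x Hx; rewrite !eval_sdiv; cbn [eval D Qpow].
  change (/ sqrt (dist2 x)) with (eval Qe x).
  change (/ ((sqrt (dist2 x) + rad) ^ 2 - m)) with (eval Ie x).
  destruct (Ie_Qe x Hx) as [HI ->]; rewrite (dot_z_Qe x) //.
  pose proof (Qe_pos x Hx) as Hq; revert Hq HI.
  generalize (eval Qe x); intros q Hq HI.
  field; lra.
Qed.

(** The distance [|x - z|], written as its square times its inverse because the grammar only has the
    inverse. *)
Definition dist : expr :=
  Mul (Add (Cst (rad ^ 2 + m)) (Mul (Cst (- 2)) (Lin z))) Qe.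

Lemma eval_dist (x : R3) : on_sphere x -> eval dist x = / eval Qe x.
Proof.
  intros Hx; pose proof (Qe_pos x Hx) as Hq; revert Hq.
  unfold dist; cbn [eval]; change (/ sqrt (dist2 x)) with (eval Qe x).
  rewrite (dot_z_Qe x) //; generalize (eval Qe x); intros; field; lra.
Qed.

Lemma J_dist : J dist = (rad ^ 2 + m / 3) / rad * area.
Proof.
  (* This is the recurrence [moment_rec] continued to [j = -1]. *)
  assert (H : 3 * J dist = (rad ^ 2 - m) ^ 2 * J (Qpow 3)
                 + 2 * (rad ^ 2 + m) * J (Qpow 1)).
  { rewrite -!surf_RInt_scal -(surf_RInt_plus (Mul _ _)).
    apply (J_sdiv _ _ (Mul (Cst (4 * rad ^ 2)) (Qpow 1)) (Cst 0) z z).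
    intros x Hx; rewrite !eval_sdiv; cbn [eval D Qpow].
    change (/ sqrt (dist2 x)) with (eval Qe x).
    rewrite eval_dist // (dot_z_Qe x) //.
    pose proof (Qe_pos x Hx) as Hq; revert Hq.
    generalize (eval Qe x); intros q Hq; field; lra. }
  rewrite J_Qe J_Qe3 in H.
  apply (Rmult_eq_reg_l 3); [rewrite H; field|]; lra.
Qed.

(** * The numerator *)

Lemma J_ext (f g : expr) :
  (forall x, on_sphere x -> eval f x = eval g x) -> J f = J g.
Proof. apply surf_RInt_ext. Qed.

(** Substituting [dot z x] gives [tan2 = - (d^2 - 2 n q^(-2) + q^(-4)) / (4 rad^2)] with
    [d = rad^2 - m] and [n = rad^2 + m], so only the moments of [q^3], [q] and [1 / q] enter. *)
Lemma J_tan2_Qe3 : J (Mul tan2 (Qpow 3)) = 2 * m / (3 * rad ^ 3) * area.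
Proof.
  rewrite (J_ext _ (Add (Mul (Cst (- (rad ^ 2 - m) ^ 2 / (4 * rad ^ 2))) (Qpow 3))
    (Add (Mul (Cst ((rad ^ 2 + m) / (2 * rad ^ 2))) (Qpow 1))
       (Mul (Cst (- / (4 * rad ^ 2))) dist)))).
  - rewrite !surf_RInt_plus !surf_RInt_scal J_Qe J_Qe3 J_dist; field; lra.
  - intros x Hx; cbn -[Qpow dist pow eval]; unfold tan2.
    cbn [eval]; rewrite !eval_Qpow eval_dist // (dot_z_Qe x) //.
    pose proof (Qe_pos x Hx) as Hq; revert Hq.
    generalize (eval Qe x); intros q Hq; field; lra.
Qed.

Lemma J_axial_dipole :
  J (Mul (Lin z) (Mul (Add (Lin z) (Cst (- m))) (Qpow 3))) = m / (3 * rad) * area.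
Proof.
  rewrite (J_ext _ (Add (Mul (Cst ((rad ^ 2 - m) * (rad ^ 2 + m) / 4)) (Qpow 3))
    (Add (Mul (Cst (- rad ^ 2 / 2)) (Qpow 1)) (Mul (Cst (/ 4)) dist)))).
  - rewrite !surf_RInt_plus !surf_RInt_scal J_Qe J_Qe3 J_dist; field; lra.
  - intros x Hx; cbn [eval]; rewrite !eval_Qpow eval_dist // (dot_z_Qe x) //.
    pose proof (Qe_pos x Hx) as Hq; revert Hq.
    generalize (eval Qe x); intros q Hq; field; lra.
Qed.

Lemma axial_decomposition (a : R3) : m <> 0 ->
  exists (k : R) (a' : R3), dot z a' = 0 /\
    forall x, dot a x = k * dot z x + dot a' x.
Proof.
  intros Hm; exists (dot z a / m).
  destruct z as [[z1 z2] z3], a as [[a1 a2] a3].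
  set (k := dot (z1, z2, z3) (a1, a2, a3) / dot (z1, z2, z3) (z1, z2, z3)).
  exists (a1 - k * z1, a2 - k * z2, a3 - k * z3); split.
  - unfold k; cbn [dot] in *; field; exact Hm.
  - intros [[x1 x2] x3]; cbn [dot]; ring.
Qed.

Lemma dot_z_degenerate (a : R3) : m = 0 -> dot z a = 0.
Proof.
  destruct z as [[z1 z2] z3], a as [[a1 a2] a3]; cbn [dot]; intros H.
  assert (z1 = 0) by nra; assert (z2 = 0) by nra; assert (z3 = 0) by nra.
  subst; ring.
Qed.

Lemma Qe_degenerate (x : R3) : m = 0 -> eval Qe x = / rad.
Proof.
  intros Hm; cbn [eval]; unfold dist2; rewrite Hm (dot_z_degenerate x Hm).
  replace (rad ^ 2 + 0 - 2 * 0) with (rad ^ 2) by ring.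
  rewrite sqrt_pow2 //; lra.
Qed.

Definition dipole (b : R3) : expr :=
  Mul (Add (Lin b) (Cst (- dot z b))) (Qpow 3).

Lemma radial_axial : radial (Mul (Add (Lin z) (Cst (- m))) (Qpow 3)).
Proof.
  apply radial_Mul; [apply radial_Add; [apply radial_Lin|apply radial_Cst]
                    |apply radial_Qpow].
Qed.

(** Both vectors are split along and across [z]. The mixed terms vanish by symmetry, and the axial
    and transverse averages carry the same factor [1 / (3 rad)], so they recombine into [dot a b]
    and the dependence on [z] disappears. *)
Lemma J_Lin_dipole (a b : R3) :
  J (Mul (Lin a) (dipole b)) = dot a b / (3 * rad) * area.
Proof.
  destruct (Req_dec m 0) as [Hm|Hm].
  (* For [z = 0] there is no axis to average around, but then [q] is the constant [/ rad]. *)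
  - rewrite (J_ext _ (Mul (Cst (/ rad ^ 3)) (Mul (Lin a) (Lin b)))).
    + rewrite surf_RInt_scal J_Lin2; field; lra.
    + intros x Hx; unfold dipole; cbn [eval]; rewrite eval_Qpow.
      rewrite (Qe_degenerate x Hm) (dot_z_degenerate b Hm); field; lra.
  - destruct (axial_decomposition a Hm) as (ka & a' & Ha & Hax).
    destruct (axial_decomposition b Hm) as (kb & b' & Hb & Hbx).
    rewrite (J_ext _ (Add (Mul (Lin a') (Mul (Lin b') (Qpow 3)))
      (Add (Mul (Cst kb) (Mul (Lin a') (Mul (Add (Lin z) (Cst (- m))) (Qpow 3))))
      (Add (Mul (Cst ka) (Mul (Lin b') (Mul (Lin z) (Qpow 3))))
        (Mul (Cst (ka * kb))
           (Mul (Lin z) (Mul (Add (Lin z) (Cst (- m))) (Qpow 3)))))))).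
    + rewrite !surf_RInt_plus !surf_RInt_scal J_azimuth2 //;
        [|apply radial_Qpow].
      rewrite J_tan2_Qe3 J_axial_dipole !J_azimuth1 //;
        [|apply radial_Mul; [apply radial_Lin|apply radial_Qpow]
         |apply radial_axial].
      rewrite Hax (dot_comm a' b) Hbx Ha (dot_comm z b) Hbx (dot_comm b' z) Hb.
      rewrite (dot_comm b' a'); field; lra.
    + intros x _; unfold dipole; cbn [eval]; rewrite !eval_Qpow Hax Hbx.
      rewrite (dot_comm z b) Hbx (dot_comm b' z) Hb; ring.
Qed.

Lemma eval_LB_Lin (a x : R3) :
  eval (LB (Lin a)) x = - 2 / rad ^ 2 * dot a x.
Proof.
  unfold LB; cbn [eval]; rewrite !eval_sdiv; cbn [eval D].
  destruct a as [[a1 a2] a3], x as [[x1 x2] x3]; unfold e1, e2, e3; cbn [dot].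
  field; lra.
Qed.

(** * The denominator *)

(* The Laplace-Beltrami operator maps the field [(x - z) / |x - z|^3] to
   [lb_x x * x + lb_z x * z]. *)
Definition lb_x (x : R3) : R :=
  let q := eval Qe x in
  (- 15 / 4 * (rad ^ 2 - m) ^ 2 * q ^ 7 + 3 / 2 * (rad ^ 2 + m) * q ^ 5
   + q ^ 3 / 4) / rad ^ 2.

Definition lb_z (x : R3) : R :=
  let q := eval Qe x in
  (3 * (rad ^ 2 - m) * q ^ 5 + q ^ 3) / rad ^ 2 - lb_x x.

(** Kept apart so that [field] can treat [q] and the coordinates of [x] as independent; the relation
    between [q] and [dot z x] on the sphere enters only in [eval_LB_dipole]. *)
Lemma eval_LB_dipole_aux (b x : R3) :
  let q := eval Qe x in let t := dot z x in
  let w := m - t ^ 2 / rad ^ 2 in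
  eval (LB (dipole b)) x =
    dot b x * (15 * q ^ 7 * w - 12 * t * q ^ 5 / rad ^ 2 - 2 * q ^ 3 / rad ^ 2)
    + dot z b * (6 * q ^ 5 - 15 * q ^ 7 * w + 6 * t * q ^ 5 / rad ^ 2).
Proof.
  intros q t w; unfold w, t; clear w t.
  unfold LB; cbn [eval]; rewrite !eval_sdiv; unfold dipole; cbn [Qpow D eval].
  change (/ sqrt (dist2 x)) with q; clearbody q.
  unfold e1, e2, e3.
  destruct z as [[z1 z2] z3], b as [[b1 b2] b3], x as [[x1 x2] x3]; cbn [dot].
  field; lra.
Qed.

Lemma eval_LB_dipole (b x : R3) : on_sphere x ->
  eval (LB (dipole b)) x = dot b x * lb_x x + dot z b * lb_z x.
Proof.
  intros Hx; rewrite eval_LB_dipole_aux; unfold lb_z, lb_x.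
  rewrite (dot_z_Qe x Hx); pose proof (Qe_pos x Hx) as Hq; revert Hq.
  generalize (eval Qe x); intros q Hq; field; lra.
Qed.

Lemma J_Qpow4 : J (Qpow 4) = area / (rad ^ 2 - m) ^ 2.
Proof.
  pose proof (moment_rec 0) as H; cbn [Nat.add INR] in H; rewrite J_Qpow0 in H.
  apply (Rmult_eq_reg_l (2 * (rad ^ 2 - m) ^ 2)); [|nra].
  field_simplify; [|lra]; field_simplify in H; lra.
Qed.

Lemma J_Qpow_step (j : nat) (k2 k0 : R) :
  J (Qpow (2 + j)) = k2 -> J (Qpow j) = k0 ->
  J (Qpow (4 + j)) = (2 * (rad ^ 2 + m) * INR j * k2 - (INR j - 2) * k0)
                       / ((INR j + 2) * (rad ^ 2 - m) ^ 2).
Proof.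
  intros <- <-; rewrite -moment_rec.
  pose proof (pos_INR j); field; split; lra.
Qed.

Lemma J_Qpow6 : J (Qpow 6) = (rad ^ 2 + m) / (rad ^ 2 - m) ^ 4 * area.
Proof.
  (* [eq_refl] leaves the logarithmic second moment unevaluated; its coefficient [INR 2 - 2] is
     zero. *)
  rewrite (J_Qpow_step 2 _ _ J_Qpow4 eq_refl) !S_INR INR_0; field; lra.
Qed.

Lemma J_Qpow8 :
  J (Qpow 8) = (4 * (rad ^ 2 + m) ^ 2 - (rad ^ 2 - m) ^ 2)
                 / (3 * (rad ^ 2 - m) ^ 6) * area.
Proof.
  rewrite (J_Qpow_step 4 _ _ J_Qpow6 J_Qpow4) !S_INR INR_0; field; lra.
Qed.

Lemma J_Qpow10 :
  J (Qpow 10) = (2 * (rad ^ 2 + m) ^ 3 - (rad ^ 2 + m) * (rad ^ 2 - m) ^ 2)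
                 / (rad ^ 2 - m) ^ 8 * area.
Proof.
  rewrite (J_Qpow_step 6 _ _ J_Qpow8 J_Qpow6) !S_INR INR_0; field; lra.
Qed.

Lemma J_Qpow12 :
  J (Qpow 12) = (16 * (rad ^ 2 + m) ^ 4
                 - 12 * (rad ^ 2 + m) ^ 2 * (rad ^ 2 - m) ^ 2 + (rad ^ 2 - m) ^ 4)
                 / (5 * (rad ^ 2 - m) ^ 10) * area.
Proof.
  rewrite (J_Qpow_step 8 _ _ J_Qpow10 J_Qpow8) !S_INR INR_0; field; lra.
Qed.

Lemma J_Qpow14 :
  J (Qpow 14) = (16 * (rad ^ 2 + m) ^ 5
                 - 16 * (rad ^ 2 + m) ^ 3 * (rad ^ 2 - m) ^ 2
                 + 3 * (rad ^ 2 + m) * (rad ^ 2 - m) ^ 4)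
                 / (3 * (rad ^ 2 - m) ^ 12) * area.
Proof.
  rewrite (J_Qpow_step 10 _ _ J_Qpow12 J_Qpow10) !S_INR INR_0; field; lra.
Qed.

(* A minorant of [rad^4 * lb_x^2]; the term it drops would contribute a
   logarithm to the integral. *)
Definition lb_x_minorant : expr :=
  Add (Mul (Cst (225 / 16 * (rad ^ 2 - m) ^ 4)) (Qpow 14))
  (Add (Mul (Cst (- 45 / 4 * (rad ^ 2 - m) ^ 2 * (rad ^ 2 + m))) (Qpow 12))
  (Add (Mul (Cst (9 / 4 * (rad ^ 2 + m) ^ 2 - 15 / 8 * (rad ^ 2 - m) ^ 2)) (Qpow 10))
       (Mul (Cst (3 / 4 * (rad ^ 2 + m))) (Qpow 8)))).

Lemma lb_x_minorant_le (x : R3) : on_sphere x ->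
  eval lb_x_minorant x <= rad ^ 4 * lb_x x ^ 2.
Proof.
  intros Hx; unfold lb_x_minorant, lb_x; cbn [eval]; rewrite !eval_Qpow.
  change (/ sqrt (dist2 x)) with (eval Qe x); generalize (eval Qe x); intros q.
  apply Rminus_le.
  match goal with |- ?d <= 0 => replace d with (- (q ^ 3 / 4) ^ 2) end.
  - pose proof (pow2_ge_0 (q ^ 3 / 4)); lra.
  - field; lra.
Qed.

Lemma radial_lb_x_minorant : radial lb_x_minorant.
Proof.
  unfold lb_x_minorant.
  repeat first [apply radial_Cst|apply radial_Qpow|apply radial_Add
               |apply radial_Mul].
Qed.

Lemma J_tan2_lb_x_minorant :
  J (Mul tan2 lb_x_minorant) =
    m * (21 * rad ^ 6 + 219 * rad ^ 4 * m + 219 * rad ^ 2 * m ^ 2 + 21 * m ^ 3)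
      / (8 * (rad ^ 2 - m) ^ 6) * area.
Proof.
  pose (d := rad ^ 2 - m); pose (n := rad ^ 2 + m).
  pose (a := 225 / 16 * d ^ 4); pose (b := - 45 / 4 * d ^ 2 * n).
  pose (c := 9 / 4 * n ^ 2 - 15 / 8 * d ^ 2); pose (e := 3 / 4 * n).
  (* The minorant multiplied by [tan2 = - (d^2 - 2 n q^(-2) + q^(-4)) / (4 rad^2)], collected by
     powers of [q]. The lowest power is the fourth, so every moment is rational. *)
  rewrite (J_ext _
    (Mul (Cst (- / (4 * rad ^ 2)))
    (Add (Mul (Cst (a * d ^ 2)) (Qpow 14))
    (Add (Mul (Cst (b * d ^ 2 - 2 * n * a)) (Qpow 12))
    (Add (Mul (Cst (c * d ^ 2 - 2 * n * b + a)) (Qpow 10))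
    (Add (Mul (Cst (e * d ^ 2 - 2 * n * c + b)) (Qpow 8))
    (Add (Mul (Cst (- 2 * n * e + c)) (Qpow 6))
         (Mul (Cst e) (Qpow 4))))))))).
  - rewrite surf_RInt_scal !surf_RInt_plus !surf_RInt_scal.
    rewrite J_Qpow14 J_Qpow12 J_Qpow10 J_Qpow8 J_Qpow6 J_Qpow4.
    unfold a, b, c, e, d, n; field; lra.
  - intros x Hx; unfold a, b, c, e, d, n, lb_x_minorant, tan2.
    cbn [eval]; rewrite !eval_Qpow (dot_z_Qe x) //.
    pose proof (Qe_pos x Hx) as Hq; revert Hq.
    generalize (eval Qe x); intros q Hq; field; lra.
Qed.

Lemma J_transverse_minorant (a : R3) : dot z a = 0 ->
  J (Mul (Lin a) (Mul (Lin a) lb_x_minorant)) =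
    dot a a * (rad ^ 2 *
      (21 * rad ^ 6 + 219 * rad ^ 4 * m + 219 * rad ^ 2 * m ^ 2 + 21 * m ^ 3))
      / (16 * (rad ^ 2 - m) ^ 6) * area.
Proof.
  intros Ha; destruct (Req_dec m 0) as [Hm|Hm].
  - rewrite (J_ext _ (Mul (Cst (63 / 16 / rad ^ 6)) (Mul (Lin a) (Lin a)))).
    + rewrite surf_RInt_scal J_Lin2 Hm; field; lra.
    + intros x Hx; unfold lb_x_minorant; cbn [eval]; rewrite !eval_Qpow.
      rewrite (Qe_degenerate x Hm) Hm; field; lra.
  - rewrite J_azimuth2 //; [|apply radial_lb_x_minorant].
    rewrite J_tan2_lb_x_minorant; field; lra.
Qed.

(* [ccross u p = (dot (cross1 p) u, dot (cross2 p) u, dot (cross3 p) u)] *)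
Definition cross1 (p : R3) : R3 := let '(p1, p2, p3) := p in (0, p3, - p2).
Definition cross2 (p : R3) : R3 := let '(p1, p2, p3) := p in (- p3, 0, p1).
Definition cross3 (p : R3) : R3 := let '(p1, p2, p3) := p in (p2, - p1, 0).

Definition LB_energy (p : R3) : expr :=
  let sq f := Mul (LB (dipole f)) (LB (dipole f)) in
  Add (sq (cross1 p)) (Add (sq (cross2 p)) (sq (cross3 p))).

Definition lb_field (x : R3) : R3 :=
  let '(x1, x2, x3) := x in let '(z1, z2, z3) := z in
  (x1 * lb_x x + z1 * lb_z x, x2 * lb_x x + z2 * lb_z x, x3 * lb_x x + z3 * lb_z x).

Lemma dot_lb_field (b x : R3) :
  dot b (lb_field x) = dot b x * lb_x x + dot z b * lb_z x.
Proof.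
  unfold lb_field; generalize (lb_x x) (lb_z x); intros s t.
  destruct z as [[z1 z2] z3], b as [[b1 b2] b3], x as [[x1 x2] x3]; cbn [dot].
  ring.
Qed.

(** Lagrange's identity for the squared length of the cross product of [lb_field x] and [p]. *)
Lemma eval_LB_energy (p x : R3) : on_sphere x ->
  eval (LB_energy p) x = dot p p * dot (lb_field x) (lb_field x)
                           - dot p (lb_field x) ^ 2.
Proof.
  intros Hx; unfold LB_energy; cbn [eval].
  rewrite !eval_LB_dipole // -!dot_lb_field.
  destruct p as [[p1 p2] p3], (lb_field x) as [[u1 u2] u3].
  cbn [dot cross1 cross2 cross3]; ring.
Qed.

Lemma dot_ge0 (p : R3) : 0 <= dot p p.
Proof. destruct p as [[p1 p2] p3]; cbn [dot]; nra. Qed.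

Lemma Cauchy_Schwarz (u v : R3) : dot u v ^ 2 <= dot u u * dot v v.
Proof.
  destruct u as [[u1 u2] u3], v as [[v1 v2] v3]; cbn [dot].
  pose proof (pow2_ge_0 (u1 * v2 - u2 * v1)).
  pose proof (pow2_ge_0 (u1 * v3 - u3 * v1)).
  pose proof (pow2_ge_0 (u2 * v3 - u3 * v2)).
  lra.
Qed.

(** The field is regrouped as [(x - z) lb_x + z (lb_x + lb_z)]: the factor [x - z] gains one power
    of the distance, and the [q^7] terms cancel in [lb_x + lb_z]. The constant is
    [882 = 2 * (361 + 80)], the 2 coming from [|u + v|^2 <= 2 |u|^2 + 2 |v|^2]. *)
Lemma lb_field_bound (x : R3) : on_sphere x ->
  dot (lb_field x) (lb_field x) <= 882 * eval Qe x ^ 8.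
Proof.
  intros Hx; pose proof (Qe_pos x Hx) as Hq.
  pose proof (dist2_pos x Hx) as Hs; pose proof (dist2_Qe x Hx) as Hsq.
  pose proof (Cauchy_Schwarz z x) as Hcs; unfold on_sphere in Hx.
  rewrite (dot_z_Qe x Hx) Hx -Hsq in Hcs.
  pose (A := - 15 / 4 * (rad ^ 2 - m) ^ 2 + 3 / 2 * (rad ^ 2 + m) * dist2 x
               + dist2 x ^ 2 / 4).
  pose (B := 3 * (rad ^ 2 - m) + dist2 x).
  assert (Hu : dot (lb_field x) (lb_field x) <=
     2 / rad ^ 4 * (eval Qe x ^ 12 * A ^ 2 + m * eval Qe x ^ 10 * B ^ 2)).
  { assert (Hsplit : dot (lb_field x) (lb_field x) <=
      2 * (dist2 x * lb_x x ^ 2 + m * (lb_x x + lb_z x) ^ 2)).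
    { unfold lb_field, dist2; rewrite -Hx.
      generalize (lb_x x) (lb_z x); intros s t.
      destruct z as [[z1 z2] z3], x as [[x1 x2] x3]; cbn [dot].
      pose proof (pow2_ge_0 ((x1 - z1) * s - z1 * (s + t))).
      pose proof (pow2_ge_0 ((x2 - z2) * s - z2 * (s + t))).
      pose proof (pow2_ge_0 ((x3 - z3) * s - z3 * (s + t))).
      lra. }
    eapply Rle_trans; [exact Hsplit|right].
    unfold A, B, lb_z, lb_x; rewrite Hsq.
    revert Hq; generalize (eval Qe x); intros q Hq; field; lra. }
  pose proof (dot_ge0 z) as Hm.
  set (s := dist2 x) in *; set (q := eval Qe x) in *.
  (* Cauchy-Schwarz for [z] and [x], rewritten in terms of [s]. It makes [rad^2 - m] at most of the
     order of the distance. *)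
  assert (Hd : (rad ^ 2 - m) ^ 2 <= 2 * (rad ^ 2 + m) * s - s ^ 2) by lra.
  assert (Hs4 : s <= 4 * rad ^ 2).
  { pose proof (pow2_ge_0 (rad ^ 2 - m)).
    assert (0 <= s * (2 * (rad ^ 2 + m) - s)) by lra; nra. }
  assert (Hd4 : (rad ^ 2 - m) ^ 2 <= 4 * rad ^ 2 * s) by nra.
  (* [361 = 19^2] and [19 = 15 + 3 + 1]: the three terms of [A] are bounded separately by multiples
     of [rad^2 * s]. *)
  assert (HA : A ^ 2 <= 361 * rad ^ 4 * s ^ 2).
  { assert (H1 : - (19 * rad ^ 2 * s) <= A) by (unfold A; nra).
    assert (H2 : A <= 19 * rad ^ 2 * s).
    { unfold A; pose proof (pow2_ge_0 (rad ^ 2 - m)); nra. }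
    nra. }
  (* [80 = 2 * (9 * 4 + 4)], from [B^2 <= 2 * (9 * (rad^2 - m)^2 + s^2)]. *)
  assert (HB : B ^ 2 <= 80 * rad ^ 2 * s).
  { unfold B; pose proof (pow2_ge_0 (3 * (rad ^ 2 - m) - s)); nra. }
  eapply Rle_trans; [exact Hu|].
  assert (HmB : m * B ^ 2 <= rad ^ 2 * (80 * rad ^ 2 * s)).
  { pose proof (pow2_ge_0 B); apply Rmult_le_compat; lra. }
  assert (Hq2 : s * q ^ 2 = 1) by (rewrite Hsq; field; lra).
  apply (Rle_trans _ (2 / rad ^ 4 * (q ^ 12 * (361 * rad ^ 4 * s ^ 2)
           + q ^ 10 * (rad ^ 2 * (80 * rad ^ 2 * s))))).
  - apply Rmult_le_compat_l.
    + apply Rlt_le, Rdiv_lt_0_compat; [lra|now apply pow_lt].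
    + apply Rplus_le_compat.
      * apply Rmult_le_compat_l; [apply pow_le; lra|exact HA].
      * rewrite (Rmult_comm m) Rmult_assoc.
        apply Rmult_le_compat_l; [apply pow_le; lra|exact HmB].
  - right.
    replace (2 / rad ^ 4 * (q ^ 12 * (361 * rad ^ 4 * s ^ 2)
               + q ^ 10 * (rad ^ 2 * (80 * rad ^ 2 * s))))
      with (q ^ 8 * (722 * (s * q ^ 2) ^ 2 + 160 * (s * q ^ 2))) by (field; lra).
    rewrite Hq2; ring.
Qed.

(** [4704 = 882 * 16 / 3]: since [m < rad^2], the numerator of the eighth moment is at most
    [16 rad^4]. *)
Lemma J_LB_energy_upper (p : R3) :
  J (LB_energy p) <= dot p p * (4704 * rad ^ 4 / (rad ^ 2 - m) ^ 6 * area).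
Proof.
  apply (Rle_trans _ (J (Mul (Cst (dot p p * 882)) (Qpow 8)))).
  - apply surf_RInt_le; intros x Hx; rewrite eval_LB_energy //; cbn [eval].
    rewrite eval_Qpow.
    pose proof (lb_field_bound x Hx); pose proof (dot_ge0 p).
    pose proof (pow2_ge_0 (dot p (lb_field x))); nra.
  - rewrite surf_RInt_scal J_Qpow8 Rmult_assoc.
    apply Rmult_le_compat_l; [apply dot_ge0|].
    rewrite -Rmult_assoc; apply Rmult_le_compat_r.
    + pose proof PI_RGT_0; pose proof (pow_lt rad 2 rad_pos); nra.
    + apply (Rmult_le_reg_r ((rad ^ 2 - m) ^ 6)); [apply pow_lt; lra|].
      field_simplify; [|lra ..].
      pose proof (dot_ge0 z); nra.
Qed.

(** The vector is [z × p], unless [z] is a multiple of [p]; then anything nonzero orthogonal to [p]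
    will do. *)
Lemma exists_orthogonal (p : R3) : dot p p <> 0 ->
  exists a : R3, 0 < dot a a /\ dot z a = 0 /\ dot p a = 0.
Proof.
  destruct z as [[z1 z2] z3], p as [[p1 p2] p3]; cbn [dot]; intros Hp.
  pose (a1 := z2 * p3 - z3 * p2); pose (a2 := z3 * p1 - z1 * p3).
  pose (a3 := z1 * p2 - z2 * p1).
  destruct (Rle_lt_dec (dot (a1, a2, a3) (a1, a2, a3)) 0) as [Ha|Ha].
  - cbn [dot] in Ha.
    assert (Ha1 : a1 = 0) by nra; assert (Ha2 : a2 = 0) by nra.
    assert (Ha3 : a3 = 0) by nra.
    pose (k := (z1 * p1 + z2 * p2 + z3 * p3) / (p1 * p1 + p2 * p2 + p3 * p3)).
    assert (Hk : forall c d r, r = 0 ->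
      c * (p1 * p1 + p2 * p2 + p3 * p3) - (z1 * p1 + z2 * p2 + z3 * p3) * d = r ->
      c = k * d) by (intros c d r -> Hr; unfold k; field_simplify_eq; lra).
    assert (Hz1 : z1 = k * p1)
      by (apply (Hk _ _ (p2 * a3 - p3 * a2)); [rewrite Ha2 Ha3; ring|unfold a2, a3; ring]).
    assert (Hz2 : z2 = k * p2)
      by (apply (Hk _ _ (p3 * a1 - p1 * a3)); [rewrite Ha1 Ha3; ring|unfold a1, a3; ring]).
    assert (Hz3 : z3 = k * p3)
      by (apply (Hk _ _ (p1 * a2 - p2 * a1)); [rewrite Ha1 Ha2; ring|unfold a1, a2; ring]).
    clear Hk Ha Ha1 Ha2 Ha3 a1 a2 a3.
    clearbody k; subst z1 z2 z3.
    destruct (Req_dec (p1 * p1 + p2 * p2) 0) as [H0|H0].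
    + exists (1, 0, 0); assert (p1 = 0) by nra; subst p1.
      repeat split; cbn [dot]; first [lra|ring].
    + exists (- p2, p1, 0); repeat split; cbn [dot]; try ring.
      destruct (Rdichotomy _ _ H0); nra.
  - exists (a1, a2, a3); split; [exact Ha|]; unfold a1, a2, a3; split; ring.
Qed.

(* The Gram determinant of [p], [a], [u] is the square of a determinant. *)
Lemma dot_orthogonal_pair (p a u : R3) : dot p a = 0 ->
  dot p p * dot a u ^ 2 <= dot a a * (dot p p * dot u u - dot p u ^ 2).
Proof.
  intros H.
  assert (Hg : 0 <= dot p p * (dot a a * dot u u - dot a u ^ 2)
    - dot p a * (dot p a * dot u u - dot a u * dot p u)
    + dot p u * (dot p a * dot a u - dot a a * dot p u)).
  { clear H; destruct p as [[p1 p2] p3], a as [[a1 a2] a3], u as [[u1 u2] u3].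
    cbn [dot].
    pose proof (pow2_ge_0 (p1 * (a2 * u3 - a3 * u2) - p2 * (a1 * u3 - a3 * u1)
      + p3 * (a1 * u2 - a2 * u1))); lra. }
  rewrite H in Hg; lra.
Qed.

(** Only the component of [lb_field] along a direction [a] orthogonal to [p] and to [z] is kept.
    Orthogonality to [p] makes it survive the cross product, and orthogonality to [z] removes
    [lb_z], leaving [dot a x * lb_x x], to which the minorant applies. *)
Lemma J_LB_energy_lower (p : R3) :
  dot p p * (21 / 16 * rad ^ 4 / (rad ^ 2 - m) ^ 6 * area) <= J (LB_energy p).
Proof.
  destruct (Req_dec (dot p p) 0) as [Hp0|Hp0].
  - rewrite Hp0 Rmult_0_l -(Rmult_0_l area) -surf_RInt_const.
    apply (surf_RInt_le (Cst 0)); intros x Hx; rewrite eval_LB_energy //.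
    cbn [eval]; pose proof (Cauchy_Schwarz p (lb_field x)); lra.
  - destruct (exists_orthogonal p Hp0) as (a & Ha & Hza & Hpa).
    pose proof (dot_ge0 p) as Hp; pose proof (dot_ge0 z) as Hm.
    apply (Rmult_le_reg_l (dot a a)); [exact Ha|].
    rewrite -surf_RInt_scal.
    apply (Rle_trans _ (J (Mul (Cst (dot p p / rad ^ 4))
      (Mul (Lin a) (Mul (Lin a) lb_x_minorant))))).
    + rewrite surf_RInt_scal J_transverse_minorant //.
      (* The added term restores the summands of [J_transverse_minorant] with a factor [m] in the
         numerator; without them [21 rad^6] remains, whence 21/16. *)
      match goal with |- ?l <= ?r => apply (Rle_trans _ (l +
        dot a a * dot p p * area * (219 * rad ^ 4 * m + 219 * rad ^ 2 * m ^ 2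
          + 21 * m ^ 3) / (16 * rad ^ 2 * (rad ^ 2 - m) ^ 6))) end.
      * rewrite -{1}(Rplus_0_r (_ * _)); apply Rplus_le_compat_l.
        pose proof PI_RGT_0; pose proof (pow_lt rad 2 rad_pos).
        pose proof (pow_lt rad 4 rad_pos).
        assert (0 < (rad ^ 2 - m) ^ 6) by (apply pow_lt; lra).
        pose proof (pow_le m 2 Hm); pose proof (pow_le m 3 Hm).
        apply Rmult_le_pos; [|apply Rlt_le, Rinv_0_lt_compat; nra].
        repeat first [lra|apply Rmult_le_pos|apply Rplus_le_le_0_compat].
      * right; field; lra.
    + apply surf_RInt_le; intros x Hx; cbn [eval].
      rewrite eval_LB_energy //.
      pose proof (dot_orthogonal_pair p a (lb_field x) Hpa) as H.
      rewrite dot_lb_field Hza Rmult_0_l Rplus_0_r in H.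
      eapply Rle_trans; [|exact H].
      pose proof (lb_x_minorant_le x Hx) as Hmin.
      apply (Rle_trans _ (dot p p / rad ^ 4 * (dot a x ^ 2 *
        (rad ^ 4 * lb_x x ^ 2)))); [|right; field; lra].
      apply Rmult_le_compat_l.
      * apply Rmult_le_pos; [exact Hp|].
        apply Rlt_le, Rinv_0_lt_compat, pow_lt, rad_pos.
      * rewrite -Rmult_assoc -(Rmult_1_r (dot a x)) -/(dot a x ^ 2).
        replace (dot a x * 1 * (dot a x * 1)) with (dot a x ^ 2) by ring.
        rewrite !Rmult_1_r; apply Rmult_le_compat_l; [apply pow2_ge_0|exact Hmin].
Qed.

(** * The point spread function *)

Lemma J_LB_LB (f g : expr) :
  J (Mul f (LB (LB g))) = J (Mul (LB f) (LB g)).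
Proof. exact (LB_symmetric f (LB g)). Qed.

Lemma eval_LB_scal (c : R) (f : expr) (x : R3) :
  eval (LB (Mul (Cst c) f)) x = c * eval (LB f) x.
Proof.
  unfold LB; cbn [eval]; rewrite !eval_sdiv; cbn [D eval]; ring.
Qed.

Lemma J_Lin_LB_LB (a : R3) (f : expr) :
  J (Mul (Lin a) (LB (LB f))) = 4 / rad ^ 4 * J (Mul (Lin a) f).
Proof.
  assert (H : forall g, J (Mul (LB (Lin a)) g) = - 2 / rad ^ 2 * J (Mul (Lin a) g)).
  { intros g; rewrite -surf_RInt_scal; apply J_ext; intros x _.
    change (eval (LB (Lin a)) x * eval g x
            = - 2 / rad ^ 2 * (dot a x * eval g x)).
    rewrite eval_LB_Lin; ring. }
  rewrite J_LB_LB H.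
  replace (J (Mul (Lin a) (LB f))) with (J (Mul (LB (Lin a)) f))
    by (symmetry; exact (LB_symmetric (Lin a) f)).
  rewrite H; field; lra.
Qed.

Definition represents3 (v : R3 -> C3) (r i : expr * expr * expr) : Prop :=
  let '(r1, r2, r3) := r in let '(i1, i2, i3) := i in
  represents (comp1 v) r1 i1 /\ represents (comp2 v) r2 i2 /\
  represents (comp3 v) r3 i3.

Definition J3 (a b : expr * expr * expr) : R :=
  let '(a1, a2, a3) := a in let '(b1, b2, b3) := b in
  J (Mul a1 (LB (LB b1))) + (J (Mul a2 (LB (LB b2))) + J (Mul a3 (LB (LB b3)))).

Lemma represents_opp_LB (f : R3 -> C) (er ei : expr) :
  represents f er ei ->
  represents (fun x => (- laplace_beltrami rad f x)%C)
    (Mul (Cst (- 1)) (LB er)) (Mul (Cst (- 1)) (LB ei)).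
Proof.
  intros H x Hx; rewrite (laplace_beltrami_represents f er ei H x Hx).
  cbn -[LB]; unfold Copp; cbn [fst snd]; f_equal; ring.
Qed.

Lemma represents_opp_LB2 (f : R3 -> C) (er ei : expr) :
  represents f er ei ->
  represents (fun x => (- laplace_beltrami rad
      (fun y => (- laplace_beltrami rad f y)%C) x)%C) (LB (LB er)) (LB (LB ei)).
Proof.
  intros H x Hx.
  rewrite (represents_opp_LB _ _ _ (represents_opp_LB f er ei H) x Hx).
  change (eval (Mul (Cst (-1)) ?e) x) with (-1 * eval e x).
  rewrite !eval_LB_scal; f_equal; ring.
Qed.

Lemma inner_gamma_represents (a b : R3 -> C3) (ar ai br bi : expr * expr * expr) :
  represents3 a ar ai -> represents3 b br bi ->
  inner_gamma rad 2 a b = (J3 ar br + J3 ai bi, J3 ai br - J3 ar bi).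
Proof.
  destruct ar as [[ar1 ar2] ar3], ai as [[ai1 ai2] ai3].
  destruct br as [[br1 br2] br3], bi as [[bi1 bi2] bi3].
  intros (A1 & A2 & A3) (B1 & B2 & B3).
  apply represents_opp_LB2 in B1, B2, B3.
  set (b' := neg_laplace_beltrami3_pow rad 2 b).
  assert (Hb : forall x, b' x = (comp1 b' x, comp2 b' x, comp3 b' x))
    by (intros x; unfold comp1, comp2, comp3; now destruct (b' x) as [[? ?] ?]).
  assert (Ha : forall x, a x = (comp1 a x, comp2 a x, comp3 a x))
    by (intros x; unfold comp1, comp2, comp3; now destruct (a x) as [[? ?] ?]).
  assert (H : forall x, on_sphere x -> cdot (a x) (cconj (b' x)) =
    (eval (Add (Add (Mul ar1 (LB (LB br1))) (Add (Mul ar2 (LB (LB br2)))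
             (Mul ar3 (LB (LB br3)))))
       (Add (Mul ai1 (LB (LB bi1))) (Add (Mul ai2 (LB (LB bi2)))
             (Mul ai3 (LB (LB bi3)))))) x,
     eval (Add (Add (Mul ai1 (LB (LB br1))) (Add (Mul ai2 (LB (LB br2)))
             (Mul ai3 (LB (LB br3)))))
       (Mul (Cst (- 1)) (Add (Mul ar1 (LB (LB bi1))) (Add (Mul ar2 (LB (LB bi2)))
             (Mul ar3 (LB (LB bi3))))))) x)).
  { intros x Hx; rewrite Ha Hb A1 // A2 // A3 //.
    change (comp1 b' x) with (- laplace_beltrami rad
      (fun y => (- laplace_beltrami rad (comp1 b) y)%C) x)%C.
    change (comp2 b' x) with (- laplace_beltrami rad
      (fun y => (- laplace_beltrami rad (comp2 b) y)%C) x)%C.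
    change (comp3 b' x) with (- laplace_beltrami rad
      (fun y => (- laplace_beltrami rad (comp3 b) y)%C) x)%C.
    rewrite (B1 x Hx) (B2 x Hx) (B3 x Hx).
    cbn -[LB]; unfold Cplus, Cmult, Cconj; cbn -[LB]; f_equal; ring. }
  unfold inner_gamma, surf_CInt, J3; fold b'; f_equal.
  - rewrite (surf_RInt_ext _ _ (fun x Hx => f_equal Re (H x Hx))).
    cbn [Re fst]; rewrite !surf_RInt_plus; ring.
  - rewrite (surf_RInt_ext _ _ (fun x Hx => f_equal Im (H x Hx))).
    cbn [Im snd]; rewrite surf_RInt_plus surf_RInt_scal !surf_RInt_plus; ring.
Qed.

Definition reC3 (u : C3) : R3 := let '(u1, u2, u3) := u in (Re u1, Re u2, Re u3).
Definition imC3 (u : C3) : R3 := let '(u1, u2, u3) := u in (Im u1, Im u2, Im u3).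

Definition cross_expr (k : R) (f : R3 -> expr) (p : R3) : expr * expr * expr :=
  (Mul (Cst k) (f (cross1 p)), Mul (Cst k) (f (cross2 p)), Mul (Cst k) (f (cross3 p))).

Lemma J3_dipole (k : R) (p : R3) :
  J3 (cross_expr k dipole p) (cross_expr k dipole p) = k ^ 2 * J (LB_energy p).
Proof.
  unfold J3, cross_expr, LB_energy.
  rewrite !surf_RInt_plus !J_LB_LB.
  assert (H : forall f, J (Mul (LB (Mul (Cst k) f)) (LB (Mul (Cst k) f)))
                        = k ^ 2 * J (Mul (LB f) (LB f))).
  { intros f; rewrite -surf_RInt_scal; apply J_ext; intros x _.
    change (eval (LB (Mul (Cst k) f)) x * eval (LB (Mul (Cst k) f)) x
            = k ^ 2 * (eval (LB f) x * eval (LB f) x)).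
    rewrite eval_LB_scal; ring. }
  rewrite !H; ring.
Qed.

(** The three products of [cross1], [cross2], [cross3] of [a] and [b] add up to [2 * dot a b]; this
    2 and the squared eigenvalue [4 / rad^4] make the 8. *)
Lemma J3_Lin_dipole (k0 k : R) (a b : R3) :
  J3 (cross_expr k0 Lin a) (cross_expr k dipole b) =
    k0 * k * (8 / (3 * rad ^ 5)) * area * dot a b.
Proof.
  unfold J3, cross_expr.
  assert (H : forall v w, J (Mul (Mul (Cst k0) (Lin v)) (LB (LB (Mul (Cst k) (dipole w)))))
    = k0 * k * (4 / (3 * rad ^ 5)) * area * dot v w).
  { intros v w.
    rewrite (J_ext _ (Mul (Cst k0) (Mul (Lin v) (LB (LB (Mul (Cst k) (dipole w)))))));
      [|intros; exact: Rmult_assoc].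
    rewrite surf_RInt_scal J_Lin_LB_LB.
    rewrite (J_ext _ (Mul (Cst k) (Mul (Lin v) (dipole w))));
      [|intros x _; change (dot v x * (k * eval (dipole w) x)
                             = k * (dot v x * eval (dipole w) x)); ring].
    rewrite surf_RInt_scal J_Lin_dipole; field; lra. }
  rewrite !H.
  destruct a as [[a1 a2] a3], b as [[b1 b2] b3]; cbn [dot cross1 cross2 cross3].
  field; lra.
Qed.

End Sphere.

(** * The gradient of the fundamental solution and the final constants *)

Lemma gradG_off_diagonal (y x : R3) : 0 < norm3 (sub3 x y) ->
  gradG y x =
    (let '(u1, u2, u3) := sub3 x y in
     let k := - / (4 * PI * norm3 (sub3 x y) ^ 3) in
     (RtoC (k * u1), RtoC (k * u2), RtoC (k * u3))).
Proof.
  intros Hn; pose proof PI_RGT_0 as HPI.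
  destruct x as [[x1 x2] x3], y as [[y1 y2] y3]; cbn [sub3] in *.
  set (n := norm3 _) in *.
  assert (Hs : sqrt ((x1 - y1) ^ 2 + (x2 - y2) ^ 2 + (x3 - y3) ^ 2) = n)
    by reflexivity.
  assert (Hp : 0 < (x1 - y1) ^ 2 + (x2 - y2) ^ 2 + (x3 - y3) ^ 2).
  { apply Rnot_le_lt; intros H; rewrite sqrt_neg_0 in Hs; lra. }
  assert (HD : forall (l : R -> R) t d, l t = (x1 - y1) ^ 2 + (x2 - y2) ^ 2 + (x3 - y3) ^ 2 ->
    is_derive l t (2 * d) ->
    Derive (fun u => 1 / (4 * PI * sqrt (l u))) t = - / (4 * PI * n ^ 3) * d).
  { intros l t d Hl Hd; apply is_derive_unique.
    apply (is_derive_ext (fun u => / (4 * PI) * / sqrt (l u))).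
    - intros u; unfold Rdiv; rewrite Rmult_1_l (Rinv_mult (4 * PI)); reflexivity.
    - replace (- / (4 * PI * n ^ 3) * d) with
        (/ (4 * PI) * (- d * (/ sqrt (l t) * (/ sqrt (l t) * / sqrt (l t)))))
        by (rewrite Hl Hs; field; lra).
      apply: is_derive_scal; apply is_derive_inv_sqrt; [rewrite Hl; exact Hp|].
      replace (-2 * - d) with (2 * d) by ring; exact Hd. }
  unfold gradG, grad, partial1, partial2, partial3, CDerive, G.
  unfold RtoC; cbn [sub3 norm3 Re Im fst snd].
  repeat f_equal; try (apply: is_derive_unique; apply: is_derive_const).
  - apply (HD (fun u => (u - y1) ^ 2 + (x2 - y2) ^ 2 + (x3 - y3) ^ 2));
      [reflexivity|auto_derive; [trivial|ring]].
  - apply (HD (fun u => (x1 - y1) ^ 2 + (u - y2) ^ 2 + (x3 - y3) ^ 2));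
      [reflexivity|auto_derive; [trivial|ring]].
  - apply (HD (fun u => (x1 - y1) ^ 2 + (x2 - y2) ^ 2 + (u - y3) ^ 2));
      [reflexivity|auto_derive; [trivial|ring]].
Qed.

(** The field [v] is real, so the real and imaginary parts of the cross product come from those of
    [beta], and each component is a pairing of the field with some vector [e], represented by
    [k * f e]. *)
Lemma represents3_ccross (rad : R) (z : R3) (v : R3 -> C3) (k : R)
    (f : R3 -> expr) (u : R3 -> R3) (beta : C3) :
  (forall x, on_sphere rad x ->
    v x = (let '(u1, u2, u3) := u x in (RtoC u1, RtoC u2, RtoC u3))) ->
  (forall x e, on_sphere rad x -> dot e (u x) = k * eval rad z (f e) x) ->
  represents3 rad z (fun x => ccross (v x) beta)
    (cross_expr k f (reC3 beta)) (cross_expr k f (imC3 beta)).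
Proof.
  intros Hv Hf; destruct beta as [[[b1r b1i] [b2r b2i]] [b3r b3i]].
  assert (He : forall e x, on_sphere rad x ->
    eval rad z (Mul (Cst k) (f e)) x = dot e (u x)) by (intros; now rewrite Hf).
  unfold represents3, cross_expr; repeat split; intros x Hx;
    rewrite !He // /comp1 /comp2 /comp3 Hv //; destruct (u x) as [[u1 u2] u3];
    cbn; unfold Cminus, Cplus, Copp, Cmult, RtoC; cbn; f_equal; ring.
Qed.

Lemma represents3_source (rad : R) (z : R3) (beta : C3) :
  0 < rad -> dot z z < rad ^ 2 ->
  represents3 rad z (fun x => ccross (gradG z x) beta)
    (cross_expr (- / (4 * PI)) (dipole z) (reC3 beta))
    (cross_expr (- / (4 * PI)) (dipole z) (imC3 beta)).
Proof.
  intros Hr Hz; pose proof PI_RGT_0 as HPI.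
  pose (k x := - / (4 * PI) * eval rad z Qe x ^ 3).
  assert (Hn : forall x, on_sphere rad x ->
    0 < norm3 (sub3 x z) /\ eval rad z Qe x = / norm3 (sub3 x z)).
  { intros x Hx; pose proof (dist2_pos rad z Hz x Hx) as Hd.
    assert (H : dot (sub3 x z) (sub3 x z) = dist2 rad z x).
    { unfold dist2; rewrite -Hx.
      destruct x as [[x1 x2] x3], z as [[z1 z2] z3]; cbn [sub3 dot]; ring. }
    split; [apply norm3_pos; lra|].
    cbn [eval]; rewrite -H -norm3_sqr sqrt_pow2 //; apply norm3_ge0. }
  apply (represents3_ccross rad z _ _ _ (fun x =>
    let '(u1, u2, u3) := sub3 x z in (k x * u1, k x * u2, k x * u3))).
  - intros x Hx; destruct (Hn x Hx) as [H1 H2].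
    rewrite gradG_off_diagonal // /k H2.
    destruct (sub3 x z) as [[u1 u2] u3].
    repeat f_equal; field; lra.
  - intros x e Hx; unfold dipole; cbn [eval]; rewrite eval_Qpow /k.
    generalize (eval rad z Qe x); intros q.
    destruct x as [[x1 x2] x3], z as [[z1 z2] z3], e as [[w1 w2] w3].
    cbn [sub3 dot]; ring.
Qed.

Lemma represents3_source_origin (rad : R) (z : R3) (alpha : C3) : 0 < rad ->
  represents3 rad z (fun x => ccross (gradG (0, 0, 0) x) alpha)
    (cross_expr (- / (4 * PI * rad ^ 3)) Lin (reC3 alpha))
    (cross_expr (- / (4 * PI * rad ^ 3)) Lin (imC3 alpha)).
Proof.
  intros Hr; pose proof PI_RGT_0 as HPI.
  apply (represents3_ccross rad z _ _ _ (fun x =>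
    let '(u1, u2, u3) := x in
    (- / (4 * PI * rad ^ 3) * u1, - / (4 * PI * rad ^ 3) * u2,
     - / (4 * PI * rad ^ 3) * u3))).
  - intros x Hx.
    assert (H : sub3 x (0, 0, 0) = x).
    { destruct x as [[x1 x2] x3]; cbn [sub3]; repeat f_equal; ring. }
    assert (Hn : norm3 (sub3 x (0, 0, 0)) = rad)
      by (rewrite H; now apply norm3_on_sphere).
    rewrite gradG_off_diagonal Hn // H; now destruct x as [[x1 x2] x3].
  - intros x e Hx; cbn [eval].
    destruct x as [[x1 x2] x3], e as [[w1 w2] w3]; cbn [dot]; ring.
Qed.

Lemma inner_gamma_origin (rad : R) (z : R3) (alpha beta : C3) :
  0 < rad -> dot z z < rad ^ 2 ->
  inner_gamma rad 2 (fun x => ccross (gradG (0, 0, 0) x) alpha)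
    (fun x => ccross (gradG z x) beta) =
  (RtoC (2 / (3 * PI * rad ^ 6)) * cdot alpha (cconj beta))%C.
Proof.
  intros Hr Hz; pose proof PI_RGT_0 as HPI.
  rewrite (inner_gamma_represents rad z Hr Hz _ _ _ _ _ _
    (represents3_source_origin rad z alpha Hr) (represents3_source rad z beta Hr Hz)).
  rewrite !J3_Lin_dipole //.
  destruct alpha as [[[a1 a1'] [a2 a2']] [a3 a3']].
  destruct beta as [[[b1 b1'] [b2 b2']] [b3 b3']].
  unfold cdot, cconj, Cconj, Cplus, Cmult, RtoC; cbn [reC3 imC3 Re Im fst snd dot].
  f_equal; field; lra.
Qed.

(** The real and imaginary parts of [beta] contribute separately, with weights
    [|Re beta|^2 + |Im beta|^2 = 1]. The energy bounds are multiplied by [4 PI rad^2 / (4 PI)^2],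
    which turns 21/16 into 21/64 and 4704 into 1176. *)
Lemma norm_gamma_bounds (rad : R) (z : R3) (beta : C3) :
  0 < rad -> dot z z < rad ^ 2 -> cnorm beta = 1 ->
  let s := Re (inner_gamma rad 2 (fun x => ccross (gradG z x) beta)
                 (fun x => ccross (gradG z x) beta)) in
  21 * rad ^ 6 / (64 * PI * (rad ^ 2 - dot z z) ^ 6) <= s /\
  s <= 1176 * rad ^ 6 / (PI * (rad ^ 2 - dot z z) ^ 6).
Proof.
  intros Hr Hz Hb; cbv zeta; pose proof PI_RGT_0 as HPI.
  pose proof (represents3_source rad z beta Hr Hz) as Hrep.
  rewrite (inner_gamma_represents rad z Hr Hz _ _ _ _ _ _ Hrep Hrep).
  cbn [Re fst]; rewrite !J3_dipole //.
  pose proof (J_LB_energy_lower rad z Hr Hz (reC3 beta)) as L1.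
  pose proof (J_LB_energy_lower rad z Hr Hz (imC3 beta)) as L2.
  pose proof (J_LB_energy_upper rad z Hr Hz (reC3 beta)) as U1.
  pose proof (J_LB_energy_upper rad z Hr Hz (imC3 beta)) as U2.
  assert (H1 : dot (reC3 beta) (reC3 beta) + dot (imC3 beta) (imC3 beta) = 1).
  { revert Hb; destruct beta as [[b1 b2] b3]; cbn [cnorm reC3 imC3 dot].
    unfold Cmod; rewrite !pow2_sqrt; try nra.
    fold (Re b1) (Im b1) (Re b2) (Im b2) (Re b3) (Im b3); intros Hb.
    apply (f_equal (fun t => t ^ 2)) in Hb; rewrite pow2_sqrt in Hb; nra. }
  set (p2 := dot (reC3 beta) _) in *; set (q2 := dot (imC3 beta) _) in *.
  set (Ep := surf_RInt _ _) in *.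
  set (Eq := surf_RInt _ (eval _ _ (LB_energy _ _ (imC3 beta)))) in *.
  clearbody p2 q2 Ep Eq.
  assert (Hk : 0 < (- / (4 * PI)) ^ 2).
  { rewrite -Rsqr_pow2; apply Rsqr_pos_lt, Ropp_neq_0_compat, Rinv_neq_0_compat; lra. }
  assert (Hd : 0 < rad ^ 2 - dot z z) by lra.
  split.
  - apply (Rle_trans _ ((- / (4 * PI)) ^ 2 * ((p2 + q2) * (21 / 16 * rad ^ 4 /
      (rad ^ 2 - dot z z) ^ 6 * (4 * PI * rad ^ 2))))).
    + right; rewrite H1; field; lra.
    + rewrite -Rmult_plus_distr_l; apply Rmult_le_compat_l; lra.
  - apply (Rle_trans _ ((- / (4 * PI)) ^ 2 * ((p2 + q2) * (4704 * rad ^ 4 /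
      (rad ^ 2 - dot z z) ^ 6 * (4 * PI * rad ^ 2))))).
    + rewrite -Rmult_plus_distr_l; apply Rmult_le_compat_l; lra.
    + right; rewrite H1; field; lra.
Qed.

(** Each power of [|z|^2] in the numerator lies between 0 and the same power of [rad^2], and
    [30 = 1 + 12 + 15 + 2]. *)
Lemma D2_bounds (rad : R) (z : R3) : 0 < rad -> dot z z < rad ^ 2 ->
  rad ^ 6 / (PI * (rad ^ 2 - dot z z) ^ 6) <= D2 rad z /\
  D2 rad z <= 30 * rad ^ 6 / (PI * (rad ^ 2 - dot z z) ^ 6).
Proof.
  intros Hr Hz; pose proof PI_RGT_0 as HPI; pose proof (dot_ge0 z) as Hm.
  assert (H4 : norm3 z ^ 4 = dot z z ^ 2) by (rewrite -norm3_sqr; ring).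
  assert (H6 : norm3 z ^ 6 = dot z z ^ 3) by (rewrite -norm3_sqr; ring).
  unfold D2; rewrite norm3_sqr H4 H6.
  assert (Hden : 0 < / (PI * (rad ^ 2 - dot z z) ^ 6)).
  { apply Rinv_0_lt_compat, Rmult_lt_0_compat; [lra|apply pow_lt; lra]. }
  replace (rad ^ 6) with ((rad ^ 2) ^ 3) by ring.
  replace (rad ^ 4) with ((rad ^ 2) ^ 2) by ring.
  assert (Hr2 : 0 < rad ^ 2) by now apply pow_lt.
  set (r := rad ^ 2) in *; set (m := dot z z) in *; clearbody r m.
  assert (M2 : m ^ 2 <= r ^ 2) by (apply pow_incr; lra).
  assert (M3 : m ^ 3 <= r ^ 3) by (apply pow_incr; lra).
  pose proof (pow_le m 2 Hm); pose proof (pow_le m 3 Hm).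
  pose proof (pow_lt r 2 Hr2).
  assert (0 <= r ^ 2 * m /\ r ^ 2 * m <= r ^ 3) by (split; nra).
  assert (0 <= r * m ^ 2 /\ r * m ^ 2 <= r ^ 3) by (split; nra).
  unfold Rdiv; split; (apply Rmult_le_compat_r; [lra|]); lra.
Qed.

Theorem proposition3p4 (rad : R) (hrad : 0 < rad) :
  exists c1 c2 : R, 0 < c1 /\ 0 < c2 /\
    forall (z : R3) (alpha beta : C3),
      norm3 z < rad -> cnorm alpha = 1 -> cnorm beta = 1 ->
      c1 * (Cmod (cdot alpha (cconj beta)) / sqrt (D2 rad z))
        <= Cmod (psf rad 2 (0, 0, 0) alpha z beta)
      /\ Cmod (psf rad 2 (0, 0, 0) alpha z beta)
        <= c2 * (Cmod (cdot alpha (cconj beta)) / sqrt (D2 rad z)).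
Proof.
  pose proof PI_RGT_0 as HPI.
  pose (k := 2 / (3 * PI * rad ^ 6)).
  assert (Hk : 0 < k).
  { unfold k; apply Rdiv_lt_0_compat; [lra|].
    pose proof (pow_lt rad 6 hrad); nra. }
  assert (Hl : 0 < sqrt (21 / 1920)) by (apply sqrt_lt_R0; lra).
  assert (Hu : 0 < sqrt 1176) by (apply sqrt_lt_R0; lra).
  (* [k] is the constant of the numerator. The squared denominator lies between [21 / 1920] and
     [1176] times [D2], where [21 / 1920] is 21/64 over the factor 30 of [D2_bounds]. *)
  exists (k / sqrt 1176), (k / sqrt (21 / 1920)).
  split; [now apply Rdiv_lt_0_compat|]; split; [now apply Rdiv_lt_0_compat|].
  intros z alpha beta Hz Ha Hb.
  assert (Hzz : dot z z < rad ^ 2).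
  { rewrite -norm3_sqr; pose proof (norm3_ge0 z); nra. }
  destruct (norm_gamma_bounds rad z beta hrad Hzz Hb) as [NL NU].
  destruct (D2_bounds rad z hrad Hzz) as [DL DU].
  assert (HT : 0 < rad ^ 6 / (PI * (rad ^ 2 - dot z z) ^ 6)).
  { apply Rdiv_lt_0_compat; [now apply pow_lt|].
    apply Rmult_lt_0_compat; [lra|apply pow_lt; lra]. }
  unfold psf; rewrite inner_gamma_origin //; unfold norm_gamma.
  set (s := Re _) in *; set (D := D2 rad z) in *.
  assert (HsL : 21 / 1920 * D <= s).
  { eapply Rle_trans; [|exact NL].
    apply (Rle_trans _ (21 / 1920 * (30 * rad ^ 6 / (PI * (rad ^ 2 - dot z z) ^ 6)))).
    - apply Rmult_le_compat_l; lra.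
    - right; field; lra. }
  assert (HsU : s <= 1176 * D).
  { eapply Rle_trans; [exact NU|].
    apply (Rle_trans _ (1176 * (rad ^ 6 / (PI * (rad ^ 2 - dot z z) ^ 6)))).
    - right; field; lra.
    - apply Rmult_le_compat_l; lra. }
  assert (HD : 0 < sqrt D) by (apply sqrt_lt_R0; lra).
  assert (Hs : 0 < sqrt s) by (apply sqrt_lt_R0; lra).
  assert (HL : sqrt (21 / 1920) * sqrt D <= sqrt s)
    by (rewrite -sqrt_mult; [apply sqrt_le_1_alt|..]; lra).
  assert (HU : sqrt s <= sqrt 1176 * sqrt D)
    by (rewrite -sqrt_mult; [apply sqrt_le_1_alt|..]; lra).
  rewrite Cmod_div; [|intros H; apply RtoC_inj in H; lra].
  rewrite Cmod_mult !Cmod_R -/k (Rabs_pos_eq k) ?(Rabs_pos_eq (sqrt s)); try lra.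
  set (X := Cmod _); assert (HX : 0 <= X) by apply Cmod_ge_0.
  split.
  - replace (k / sqrt 1176 * (X / sqrt D)) with (k * X * / (sqrt 1176 * sqrt D))
      by (field; lra).
    apply Rmult_le_compat_l; [apply Rmult_le_pos; lra|].
    now apply Rinv_le_contravar.
  - replace (k / sqrt (21 / 1920) * (X / sqrt D))
      with (k * X * / (sqrt (21 / 1920) * sqrt D)) by (field; lra).
    apply Rmult_le_compat_l; [apply Rmult_le_pos; lra|].
    apply Rinv_le_contravar; [now apply Rmult_lt_0_compat|exact HL].
Qed.
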